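(* Let $A$ be the CAR algebra. Given any $\mathbf{z} \in KK^0(A,\mathbf{C})$ and any $[x] \in K_0(A)$, we have $\langle ch_*(\mathbf{z}), [x] \rangle = 0$.
   Context: The CAR algebra is the C*-algebra inductive limit $A = \varinjlim A_n$, where for each positive integer $n$, $A_n = M_{2^n}(\mathbf{C})$, with connecting *-homomorphisms $\phi_{n+1,n}: A_n \to A_{n+1}$, $B \mapsto \begin{pmatrix} B & 0 \\ 0 & B \end{pmatrix}$. $KK^0(A,\mathbf{C})$ is the even K-homology of $A$, whose elements are represented by even Fredholm modules $(H,\pi,F,\gamma)$: $H$ is a Hilbert space with grading operator $\gamma$ ($\gamma=\gamma^*$, $\gamma^2=1$), $\pi$ is a (not necessarily unital) *-representation of $A$ on $H$ commuting with $\gamma$, and $F=F^*$, $F^2=1$, $F\gamma=-\gamma F$, with $[F,\pi(a)]$ compact for all $a\in A$. $\langle ch_*(\mathbf{z}),[x]\rangle$ denotes the canonical bilinear (index) pairing $KK^0(A,\mathbf{C})\times K_0(A)\to\mathbf{Z}$ between K-homology and K-theory. If $\mathbf{z}$ is represented by $(H,\pi,F,\gamma)$, $H^\pm$ are the $\pm1$ eigenspaces of $\gamma$, and $p\in M_k(A)$ is a projection, then $\langle ch_*(\mathbf{z}),[p]\rangle$ is the Fredholm index of the operator $\pi(p)(F\otimes 1_k)\pi(p): \pi(p)(H^+\otimes\mathbf{C}^k)\to\pi(p)(H^-\otimes\mathbf{C}^k)$, where $\pi$ is extended to matrices entrywise. When the module is finitely summable (on a dense subalgebra over which $p$ is defined),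 this agrees with the pairing of Connes' even Chern character $ch_*(\mathbf{z})$ in even periodic cyclic cohomology with K-theory, given for a projection $p$ in the algebra, for all sufficiently large $k$, by $(-1)^k\,\mathrm{Tr}(\gamma\pi(p)[F,\pi(p)]^{2k})$. *)

(* Defs.v *)
(* The complex numbers are R[i] for R : realType. *)
From HB Require Import structures.
From mathcomp Require Import all_boot all_order all_algebra.
From mathcomp Require Import all_classical all_reals all_analysis.
From mathcomp Require Import complex.

Set Implicit Arguments.
Unset Strict Implicit.
Unset Printing Implicit Defensive.

Import Order.TTheory GRing.Theory Num.Theory.
Import numFieldNormedType.Exports.

Local Open Scope classical_set_scope.
Local Open Scope ring_scope.
Local Open Scope complex_scope.
Local Open Scope sesquilinear_scope.

(* [{dot H for Num.conj}] is the library's type of positive definite hermitian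
   forms, linear in the first and conjugate-linear in the second variable. *)
HB.mixin Record CompleteNormedModule_isHilbert (R : realType) H
    of CompleteNormedModule R[i] H := {
  inner : {dot H for @Num.conj R[i]};
  inner_norm : forall x : H, inner x x = `|x| ^+ 2
}.

#[short(type="hilbertType")]
HB.structure Definition Hilbert (R : realType) :=
  {H of CompleteNormedModule R[i] H & CompleteNormedModule_isHilbert R H}.

(* On a normed space, a linear map is bounded iff it is continuous. *)
Definition bounded_operator (R : realType) (H : hilbertType R) (T : H -> H) :=
  linear T /\ continuous T.

Definition adjoint_pair (R : realType) (H : hilbertType R) (T S : H -> H) :=
  forall x y : H, inner (T x) y = inner x (S y).

Definition compact_operator (R : realType) (H : hilbertType R) (T : H -> H) :=
  precompact (T @` [set x : H | `|x| <= 1]).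

(* The norm is a field of the structure rather than an instance of the
   library's normed modules: the hierarchy has no join of rings and normed
   modules other than numerical domains. *)
HB.mixin Record isCStar (R : realType) A of GRing.Algebra R[i] A := {
  star : A -> A;
  star_conj_linear : forall (k : R[i]) (a b : A),
    star (k *: a + b) = k^* *: star a + star b;
  starM : forall a b : A, star (a * b) = star b * star a;
  starK : forall a : A, star (star a) = a;
  cnorm : A -> R;
  cnorm_eq0 : forall a : A, cnorm a = 0 -> a = 0;
  cnormD : forall a b : A, cnorm (a + b) <= cnorm a + cnorm b;
  cnormZ : forall (k : R[i]) (a : A), (cnorm (k *: a))%:C = `|k| * (cnorm a)%:C;
  cnormM : forall a b : A, cnorm (a * b) <= cnorm a * cnorm b;
  cnorm_starM : forall a : A, cnorm (star a * a) = cnorm a ^+ 2;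
  cnorm_complete : forall u : nat -> A,
    (forall e : R, 0 < e -> exists N : nat, forall m n : nat,
       (N <= m)%N -> (N <= n)%N -> cnorm (u m - u n) < e) ->
    exists l : A, forall e : R, 0 < e -> exists N : nat, forall n : nat,
       (N <= n)%N -> cnorm (u n - l) < e
}.

(* [GRing.Algebra] makes these unital and nonzero. *)
#[short(type="cstarAlgType")]
HB.structure Definition CStar (R : realType) :=
  {A of GRing.Algebra R[i] A & isCStar R A}.

Lemma car_dim (n : nat) : (2 ^ n + 2 ^ n = 2 ^ n.+1)%N.
Proof. by rewrite addnn -mul2n expnS. Qed.

Definition car_connect (R : realType) (n : nat) (B : 'M[R[i]]_(2 ^ n)) :
    'M[R[i]]_(2 ^ n.+1) :=
  castmx (car_dim n, car_dim n) (block_mx B 0 0 B).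

(* [iota n] is the canonical map of the n-th matrix algebra into the limit and
   is only meaningful for [0 < n].  An injective *-homomorphism between
   C*-algebras is isometric, so these conditions say that [A] is the completion
   of the union of the increasing sequence of the matrix algebras in its
   C*-norm. *)
Record is_CAR_limit (R : realType) (A : cstarAlgType R)
    (iota : forall n : nat, 'M[R[i]]_(2 ^ n) -> A) : Prop := {
  car_linear : forall n, (0 < n)%N -> linear (iota n);
  car_mul : forall n, (0 < n)%N ->
    forall B D, iota n (B *m D) = iota n B * iota n D;
  car_star : forall n, (0 < n)%N -> forall B, iota n (B ^t*) = star (iota n B);
  car_inj : forall n, (0 < n)%N -> injective (iota n);
  car_compat : forall n, (0 < n)%N ->
    forall B, iota n.+1 (car_connect B) = iota n B;
  car_dense : forall (a : A) (e : R), 0 < e ->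
    exists (n : nat) (B : 'M[R[i]]_(2 ^ n)),
      (0 < n)%N /\ cnorm (a - iota n B) < e
}.

Definition is_CAR_algebra (R : realType) (A : cstarAlgType R) : Prop :=
  exists iota : (forall n : nat, 'M[R[i]]_(2 ^ n) -> A), is_CAR_limit iota.

Definition adjmx (R : realType) (A : cstarAlgType R) (m n : nat)
    (a : 'M[A]_(m, n)) : 'M[A]_(n, m) := map_mx star a^T.

Definition is_projection (R : realType) (A : cstarAlgType R) (k : nat)
    (p : 'M[A]_k) : Prop := p *m p = p /\ adjmx p = p.

Record projection (R : realType) (A : cstarAlgType R) := Projection {
  psize : nat;
  pmx : 'M[A]_psize;
  pmxP : is_projection pmx
}.

Lemma is_projection_block (R : realType) (A : cstarAlgType R)
    (p q : projection A) : is_projection (block_mx (pmx p) 0 0 (pmx q)).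
Proof.
have star0 : star (0 : A) = 0.
  have := @star_conj_linear R A 1 0 0; rewrite scaler0 addr0 rmorph1 scale1r.
  by move/eqP; rewrite addrC -subr_eq0 opprD addrA subrr sub0r oppr_eq0 => /eqP.
have adj0 m n : adjmx (0 : 'M[A]_(m, n)) = 0.
  by apply/matrixP=> i j; rewrite !mxE star0.
have [[pp ps] [qq qs]] := (pmxP p, pmxP q).
split; first by rewrite mulmx_block !mulmx0 !mul0mx !addr0 add0r pp qq.
rewrite /adjmx tr_block_mx map_block_mx.
by rewrite -/(adjmx _) ps -/(adjmx (pmx q)) qs -!/(adjmx _) !adj0.
Qed.

Definition psum (R : realType) (A : cstarAlgType R) (p q : projection A) :
  projection A := Projection (is_projection_block p q).

Definition mvn_equiv (R : realType) (A : cstarAlgType R)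
    (p q : projection A) : Prop :=
  exists v : 'M[A]_(psize q, psize p),
    adjmx v *m v = pmx p /\ v *m adjmx v = pmx q.

(* A pair (p, q) stands for the formal difference [p] - [q]; this is equality
   of formal differences in the Grothendieck group. *)
Definition K0_equiv (R : realType) (A : cstarAlgType R)
    (d e : projection A * projection A) : Prop :=
  exists r : projection A,
    mvn_equiv (psum (psum d.1 e.2) r) (psum (psum e.1 d.2) r).

(* K_0(A) as the set of equivalence classes of formal differences. *)
Record K0 (R : realType) (A : cstarAlgType R) := K0Class {
  K0_mem : projection A * projection A -> Prop;
  K0_memP : exists d, K0_mem = K0_equiv d
}.

(* No unitality: pi 1 may be a proper projection. *)
Record is_star_rep (R : realType) (A : cstarAlgType R) (H : hilbertType R)
    (pi : A -> H -> H) : Prop := {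
  rep_bounded : forall a, bounded_operator (pi a);
  rep_linear : forall (k : R[i]) (a b : A) (x : H),
    pi (k *: a + b) x = k *: pi a x + pi b x;
  rep_mul : forall (a b : A) (x : H), pi (a * b) x = pi a (pi b x);
  rep_star : forall a : A, adjoint_pair (pi a) (pi (star a))
}.

Record is_even_fredholm (R : realType) (A : cstarAlgType R) (H : hilbertType R)
    (pi : A -> H -> H) (F gamma : H -> H) : Prop := {
  fm_rep : is_star_rep pi;
  fm_F_bounded : bounded_operator F;
  fm_gamma_bounded : bounded_operator gamma;
  fm_gamma_selfadj : adjoint_pair gamma gamma;
  fm_gamma_sqr : forall x, gamma (gamma x) = x;
  fm_rep_even : forall a x, gamma (pi a x) = pi a (gamma x);
  fm_F_selfadj : adjoint_pair F F;
  fm_F_sqr : forall x, F (F x) = x;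
  fm_F_odd : forall x, F (gamma x) = - gamma (F x);
  fm_compact : forall a, compact_operator (fun x => F (pi a x) - pi a (F x))
}.

Record even_fredholm (R : realType) (A : cstarAlgType R) := EvenFredholm {
  fm_space : hilbertType R;
  fm_pi : A -> fm_space -> fm_space;
  fm_F : fm_space -> fm_space;
  fm_gamma : fm_space -> fm_space;
  fm_axioms : is_even_fredholm fm_pi fm_F fm_gamma
}.
Arguments fm_pi {R A} m a x : rename.
Arguments fm_F {R A} m x : rename.
Arguments fm_gamma {R A} m x : rename.

Definition fm_degenerate (R : realType) (A : cstarAlgType R)
    (d : even_fredholm A) : Prop :=
  forall a x, fm_F d (fm_pi d a x) = fm_pi d a (fm_F d x).

(* V is an isometric embedding of m into (H, pi, F, gamma) which intertwines
   all the operators. *)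
Definition fm_embedding (R : realType) (A : cstarAlgType R)
    (m : even_fredholm A) (H : hilbertType R) (pi : A -> H -> H)
    (F gamma : H -> H) (V : fm_space m -> H) : Prop :=
  [/\ linear V,
      forall x y, inner (V x) (V y) = inner x y,
      forall a x, V (fm_pi m a x) = pi a (V x),
      forall x, V (fm_F m x) = F (V x)
    & forall x, V (fm_gamma m x) = gamma (V x)].

(* (H, pi, F, gamma) is unitarily equivalent to the orthogonal direct sum of
   m and d. *)
Definition fm_direct_sum (R : realType) (A : cstarAlgType R)
    (m d : even_fredholm A) (H : hilbertType R) (pi : A -> H -> H)
    (F gamma : H -> H) : Prop :=
  exists (V : fm_space m -> H) (W : fm_space d -> H),
    [/\ fm_embedding pi F gamma V, fm_embedding pi F gamma W,
        forall x y, inner (V x) (W y) = 0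
      & forall z, exists x y, z = V x + W y].

(* Norm-continuous path of operators F_t, t in [0, 1], through even Fredholm
   modules with fixed space, representation and grading. *)
Definition operator_homotopy (R : realType) (A : cstarAlgType R)
    (H : hilbertType R) (pi : A -> H -> H) (F : R -> H -> H)
    (gamma : H -> H) : Prop :=
  (forall t : R, 0 <= t <= 1 -> is_even_fredholm pi (F t) gamma) /\
  (forall s e : R, 0 <= s <= 1 -> 0 < e ->
     exists2 d : R, 0 < d & forall t : R, 0 <= t <= 1 -> `|t - s| < d ->
       forall x : H, `|F t x - F s x| <= e%:C * `|x|).

(* Equality in KK^0(A, C): unitary equivalence and operator homotopy after
   addition of degenerate modules. *)
Definition KK0_equiv (R : realType) (A : cstarAlgType R)
    (m1 m2 : even_fredholm A) : Prop :=
  exists (d1 d2 : even_fredholm A) (H : hilbertType R) (pi : A -> H -> H)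
         (F : R -> H -> H) (gamma : H -> H),
    [/\ fm_degenerate d1, fm_degenerate d2, operator_homotopy pi F gamma,
        fm_direct_sum m1 d1 pi (F 0) gamma
      & fm_direct_sum m2 d2 pi (F 1) gamma].

Record KK0 (R : realType) (A : cstarAlgType R) := KK0Class {
  KK0_mem : even_fredholm A -> Prop;
  KK0_memP : exists m, KK0_mem = KK0_equiv m
}.

(* For linear subspaces S of E: the quotient E / S has dimension n.  The e_i
   represent a basis of the quotient. *)
Definition quot_dim (K : fieldType) (V : lmodType K) (E S : set V) (n : nat) :
    Prop :=
  exists e : 'I_n -> V, (forall i, E (e i)) /\
    forall v, E v -> exists! c : 'rV[K]_n, S (v - \sum_i c 0 i *: e i).

(* The operator T : D -> E between subspaces is Fredholm of index m, i.e. has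
   finite-dimensional kernel and cokernel and
   m = dim (ker T) - dim (coker T). *)
Definition has_fredholm_index (K : fieldType) (V : lmodType K) (D E : set V)
    (T : V -> V) (m : int) : Prop :=
  exists a b : nat,
    [/\ quot_dim [set v | D v /\ T v = 0] [set 0] a,
        quot_dim E (T @` D) b & m = a%:Z - b%:Z].

(* The action of a matrix over A on the k-fold sum of H, i.e. on the tensor
   product of H with C^k. *)
Definition rep_mx (R : realType) (A : cstarAlgType R) (H : hilbertType R)
    (pi : A -> H -> H) (k : nat) (p : 'M[A]_k) (v : {ffun 'I_k -> H}) :
    {ffun 'I_k -> H} :=
  [ffun i => \sum_j pi (p i j) (v j)].

(* With s = 1 or s = -1, the image under pi(p) of the k-fold sum of the
   s-eigenspace of gamma. *)
Definition corner_space (R : realType) (A : cstarAlgType R)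
    (m : even_fredholm A) (k : nat) (p : 'M[A]_k) (s : R[i]) :
    set {ffun 'I_k -> fm_space m} :=
  rep_mx (fm_pi m) p @`
    [set u : {ffun 'I_k -> fm_space m} | forall i, fm_gamma m (u i) = s *: u i].

Definition corner_operator (R : realType) (A : cstarAlgType R)
    (m : even_fredholm A) (k : nat) (p : 'M[A]_k)
    (v : {ffun 'I_k -> fm_space m}) : {ffun 'I_k -> fm_space m} :=
  rep_mx (fm_pi m) p
    [ffun i => fm_F m (rep_mx (fm_pi m) p v i)].

Definition module_index (R : realType) (A : cstarAlgType R)
    (m : even_fredholm A) (p : projection A) (n : int) : Prop :=
  has_fredholm_index (corner_space (m := m) (pmx p) 1)
    (corner_space (m := m) (pmx p) (-1))
    (corner_operator (m := m) (pmx p)) n.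

(* <ch_*(z), x> = n: whichever Fredholm module m represents z and whichever
   formal difference [p] - [q] represents x, the compressions of F to p and to
   q are Fredholm and the difference of their indices is n. *)
Definition index_pairing (R : realType) (A : cstarAlgType R)
    (z : KK0 A) (x : K0 A) (n : int) : Prop :=
  forall (m : even_fredholm A) (p q : projection A),
    KK0_mem z m -> K0_mem x (p, q) ->
    exists i j : int, [/\ module_index m p i, module_index m q j & n = i - j].

(* Main.v *)
From HB Require Import structures.
Require Import Defs.
From mathcomp Require Import all_boot all_order all_algebra.
From mathcomp Require Import all_classical all_reals all_analysis.
From mathcomp Require Import complex zify ring lra.

Set Implicit Arguments.
Unset Strict Implicit.
Unset Printing Implicit Defensive.

Import Order.TTheory GRing.Theory Num.Theory.
Import numFieldNormedType.Exports.

Local Open Scope classical_set_scope.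
Local Open Scope ring_scope.
Local Open Scope complex_scope.
Local Open Scope sesquilinear_scope.

(** A Fredholm module assigns to every idempotent [p] in a matrix algebra over
    [A] the index of its corner operator [p F p].  The proof shows that this
    index is a homomorphism on idempotents with integer values, and that every
    idempotent over the CAR algebra is infinitely divisible by 2; an integer
    which is infinitely divisible by 2 is 0.  In terms of K-theory:
    multiplication by 2 is onto on K_0(A), so K_0(A) has no nonzero homomorphism
    to Z.

    Homomorphism property.  The operator [F] commutes with the action of [A]
    modulo compact operators and squares to the identity, so [p F p] is its own
    inverse modulo compact operators ([corner_operator_sqr]).  Hence it is
    Fredholm, and its index does not change under compact perturbations
    ([fredholm_of_parametrix], [fredholm_index_perturb]).  Equivalent
    idempotents have conjugate corner operators up to a compact operator
    ([has_index_equiv]), and the corner operator of a sum of two orthogonal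
    idempotents is, up to a compact operator, a direct sum ([has_index_sum]).

    Divisibility.  The entries of [p] are close to elements of one matrix
    algebra [A_n], and the 2 x 2 matrix units in [A_(n+1)] commute with [A_n].
    If [b] has entries in [A_n] and is close to [p], then some idempotent [q]
    equivalent to [p] commutes with everything that commutes with [b]
    ([idempotent_perturbation]), in particular with the matrix units [f_ij].
    Then [q] is the orthogonal sum of [f_11 q] and [f_22 q], which are
    equivalent through [f_12 q] and [f_21 q] ([car_halving]).  So the index of
    [p] is twice the index of [f_11 q], and descent gives 0
    ([has_index_halving]).  Idempotents and similarity replace projections and
    unitary equivalence throughout, because they are reached by a contracting
    fixed point equation and inverses near 1, whereas projections and unitaries
    would call for square roots and polar decompositions.

    Fredholm theory.  On a Hilbert space a compact operator is a norm limit of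
    operators of finite rank ([compact_almost_finite_rank]).  Therefore, on the
    range of a bounded idempotent, a compact perturbation of the identity that
    preserves this range is a bijection plus an operator of finite rank
    ([riesz_decomposition]).  What remains is linear algebra of subspaces of
    finite codimension, where the index is computed on a subspace on which the
    operator is injective ([fredholm_index]). *)
(** * Subspaces and finite codimension *)

Definition subspace (K : fieldType) (V : lmodType K) (E : set V) :=
  E 0 /\ forall (a : K) x y, E x -> E y -> E (a *: x + y).

Definition linear_on (K : fieldType) (V W : lmodType K) (E : set V)
    (f : V -> W) :=
  forall (a : K) x y, E x -> E y -> f (a *: x + y) = a *: f x + f y.

(** The dimension of [E / S], witnessed by a linear map from [E] onto the row
    vectors whose kernel in [E] is [S]: such maps restrict, compose and
    concatenate, which lifted bases do not. *)
Definition codim (K : fieldType) (V : lmodType K) (E S : set V) (n : nat) :=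
  exists f : V -> 'rV[K]_n,
    [/\ linear_on E f, forall x, E x -> (f x = 0 <-> S x)
      & forall c, exists2 x, E x & f x = c].

Section Subspaces.
Variables (K : fieldType) (V W : lmodType K).
Implicit Types (E S G : set V) (f : V -> W).

Lemma subspaceZ E a x : subspace E -> E x -> E (a *: x).
Proof. by move=> [E0 EL] Ex; rewrite -[_ *: _]addr0; exact: EL. Qed.

Lemma subspaceD E x y : subspace E -> E x -> E y -> E (x + y).
Proof. by move=> [E0 EL] Ex Ey; rewrite -[x]scale1r; exact: EL. Qed.

Lemma subspaceB E x y : subspace E -> E x -> E y -> E (x - y).
Proof.
move=> sE Ex Ey; apply: subspaceD => //.
by rewrite -scaleN1r; exact: subspaceZ.
Qed.

Lemma subspace_sum E n (F : 'I_n -> V) :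
  subspace E -> (forall i, E (F i)) -> E (\sum_i F i).
Proof.
move=> sE EF; elim/big_ind: _ => //; first by case: sE.
by move=> x y; exact: subspaceD.
Qed.

Lemma linear_on0 E f : subspace E -> linear_on E f -> f 0 = 0.
Proof.
move=> [E0 _] /(_ (-1) 0 0 E0 E0).
by rewrite scaler0 addr0 scaleN1r addNr.
Qed.

Lemma linear_onZ E f a x : subspace E -> linear_on E f -> E x ->
  f (a *: x) = a *: f x.
Proof.
move=> sE fL Ex; rewrite -[a *: x]addr0 fL // ?(linear_on0 sE fL) ?addr0 //.
by case: sE.
Qed.

Lemma linear_onB E f x y : subspace E -> linear_on E f -> E x -> E y ->
  f (x - y) = f x - f y.
Proof.
move=> sE fL Ex Ey; rewrite addrC -scaleN1r fL //.
by rewrite scaleN1r addrC.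
Qed.

Lemma linear_on_sum E f n (c : 'I_n -> K) (e : 'I_n -> V) :
  subspace E -> linear_on E f -> (forall i, E (e i)) ->
  f (\sum_i c i *: e i) = \sum_i c i *: f (e i).
Proof.
move=> sE fL Ee.
suff [] : E (\sum_i c i *: e i) /\
  f (\sum_i c i *: e i) = \sum_i c i *: f (e i) by [].
apply: (big_ind2 (fun x y => E x /\ f x = y)).
- by case: (sE) => E0 _; rewrite (linear_on0 sE fL).
- move=> x _ y _ [Ex <-] [Ey <-]; split; first exact: subspaceD.
  by rewrite -[x]scale1r fL // !scale1r.
- by move=> i _; split; [exact: subspaceZ | exact: (linear_onZ _ sE fL)].
Qed.

Lemma linear_linear_on E f : linear f -> linear_on E f.
Proof. by move=> fL a x y _ _; exact: fL. Qed.

Lemma linear_onS E G f : G `<=` E -> linear_on E f -> linear_on G f.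
Proof. by move=> GE fL a x y /GE Ex /GE Ey; exact: fL. Qed.

Lemma subspaceT : subspace [set: V].
Proof. by split. Qed.

Lemma subspace0 : subspace [set (0 : V)].
Proof. by split=> // a x y -> ->; rewrite scaler0 addr0. Qed.

Lemma subspace_image E f : subspace E -> linear_on E f -> subspace (f @` E).
Proof.
move=> sE fL; split; first by exists 0; [case: sE | exact: (linear_on0 sE fL)].
move=> a _ _ [x Ex <-] [y Ey <-]; exists (a *: x + y); last exact: fL.
by case: sE => _; exact.
Qed.

Lemma subspace_preim E f (U : set W) : subspace E -> linear_on E f ->
  subspace U -> subspace [set x | E x /\ U (f x)].
Proof.
move=> sE fL sU; split.
  split; first by case: sE.
  by rewrite (linear_on0 sE fL); case: sU.
move=> a x y [Ex Ux] [Ey Uy]; split; first by case: sE => _; exact.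
by rewrite fL //; case: sU => _; exact.
Qed.

End Subspaces.

Section Codim.
Variables (K : fieldType).
Implicit Types (V W : lmodType K).

Lemma codim_basis V (E : set V) n (f : V -> 'rV[K]_n) :
  (forall c, exists2 x, E x & f x = c) ->
  exists e : 'I_n -> V, (forall i, E (e i)) /\ forall i, f (e i) = delta_mx 0 i.
Proof.
move=> fs; have /choice[e He] :
    forall i : 'I_n, exists x, E x /\ f x = delta_mx 0 i.
  by move=> i; have [x] := fs (delta_mx 0 i); exists x.
by exists e; split=> i; case: (He i).
Qed.

Lemma codim_coord V (E : set V) n (f : V -> 'rV[K]_n) (e : 'I_n -> V)
    (c : 'I_n -> K) :
  subspace E -> linear_on E f -> (forall i, E (e i)) ->
  (forall i, f (e i) = delta_mx 0 i) ->
  f (\sum_i c i *: e i) = \row_i c i.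
Proof.
move=> sE fL Ee fe; rewrite (linear_on_sum _ sE fL Ee).
rewrite [RHS]row_sum_delta; apply: eq_bigr => i _; by rewrite fe mxE.
Qed.

Lemma codim_quot_dim V (E S : set V) n : subspace E -> subspace S ->
  S `<=` E -> codim E S n -> exists e : 'I_n -> V, (forall i, E (e i)) /\
    forall v, E v -> exists! c : 'rV[K]_n, S (v - \sum_i c 0 i *: e i).
Proof.
move=> sE sS SE [f [fL fS fs]]; have [e [Ee fe]] := codim_basis fs.
exists e; split=> // v Ev.
have Es (c : 'rV[K]_n) : E (\sum_i c 0 i *: e i).
  by apply: subspace_sum => // i; exact: subspaceZ.
have fv (c : 'rV[K]_n) : f (v - \sum_i c 0 i *: e i) = f v - c.
  rewrite (linear_onB sE fL) // (codim_coord _ sE fL) //.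
  by congr (_ - _); apply/rowP=> i; rewrite mxE.
have Ed (c : 'rV[K]_n) : E (v - \sum_i c 0 i *: e i) by exact: subspaceB.
exists (f v); split=> [|c].
  by apply/fS => //; rewrite fv subrr.
by move/(fS _ (Ed _)); rewrite fv => /eqP; rewrite subr_eq0 => /eqP.
Qed.

Lemma codim_leq V (E S : set V) m n : subspace E ->
  codim E S m -> codim E S n -> (m <= n)%N.
Proof.
move=> sE [f [fL fS fs]] [g [gL gS gs]]; have [e [Ee fe]] := codim_basis fs.
pose M := \matrix_i g (e i).
suff /eqP <- : row_free M by exact: rank_leq_col.
apply: inj_row_free => c cM.
have Es : E (\sum_i c 0 i *: e i).
  by apply: subspace_sum => // i; exact: subspaceZ.
suff : f (\sum_i c 0 i *: e i) = 0.
  rewrite (codim_coord _ sE fL) // => <-.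
  by apply/rowP=> i; rewrite mxE.
apply/fS => //; apply/gS => //; rewrite (linear_on_sum _ sE gL Ee).
rewrite -[RHS]cM mulmx_sum_row; apply: eq_bigr => i _.
by rewrite rowK.
Qed.

Lemma codim_uniq V (E S : set V) m n : subspace E ->
  codim E S m -> codim E S n -> m = n.
Proof.
by move=> sE Em En; apply/eqP; rewrite eqn_leq !(@codim_leq V E S).
Qed.

(** A matrix of maximal rank with rows in [U] spans [U]. *)
Lemma subspace_rowspace n (U : set 'rV[K]_n) : subspace U ->
  exists M : 'M[K]_n, forall u, U u <-> (u <= M)%MS.
Proof.
move=> sU.
pose P r :=
  `[< exists M : 'M[K]_n, (forall i, U (row i M)) /\ \rank M = r >].
have exP : exists r, P r.
  exists 0; apply/asboolP; exists 0; split=> [i|]; last by rewrite mxrank0.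
  by rewrite row0; case: sU.
have leP r : P r -> (r <= n)%N.
  by move=> /asboolP[M [_ <-]]; exact: rank_leq_col.
have [r /asboolP[M [MU rM]] rmax] := ex_maxnP exP leP.
have subU m (N : 'M[K]_(m, n)) : (forall i, U (row i N)) ->
    forall u : 'rV_n, (u <= N)%MS -> U u.
  move=> NU u /submxP[D ->]; rewrite mulmx_sum_row.
  by apply: subspace_sum => // i; exact: subspaceZ.
exists M => u; split; last exact: subU.
move=> Uu; pose N := <<(M + u)%MS>>%MS.
have NU i : U (row i N).
  apply: (subU _ (col_mx M u)) => [j|].
    rewrite -(splitK j); case: (fintype.split j) => l /=.
      by rewrite rowKu.
    by rewrite rowKd row_id.
  by rewrite -addsmxE (submx_trans (row_sub _ _)) // genmxE.
have /rmax : P (\rank N) by apply/asboolP; exists N.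
rewrite -rM genmxE => le_r.
have : (M == (M + u)%MS)%MS.
  rewrite -mxrank_leqif_eq ?addsmxSl // eqn_leq le_r mxrankS //.
  exact: addsmxSl.
by move/eqmxP=> ->; exact: addsmxSr.
Qed.

Lemma codim_ker V (E S : set V) n (f : V -> 'rV[K]_n) : subspace E ->
  linear_on E f -> (forall x, E x -> (S x <-> f x = 0)) ->
  exists r, codim E S r.
Proof.
move=> sE fL fS; have [M HM] := subspace_rowspace (subspace_image sE fL).
have fM x : E x -> (f x <= row_base M)%MS.
  by move=> Ex; rewrite eq_row_base; apply/HM; exists x.
exists (\rank M), (fun x => f x *m pinvmx (row_base M)); split.
- by move=> a x y Ex Ey; rewrite fL // mulmxDl scalemxAl.
- move=> x Ex; rewrite fS //; split=> [f0|->]; last by rewrite mul0mx.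
  by rewrite -(mulmxKpV (fM x Ex)) f0 mul0mx.
- move=> c; have /HM[x Ex fx] : (c *m row_base M <= M)%MS.
    by rewrite (submx_trans (submxMl _ _)) // eq_row_base.
  exists x => //; apply: (row_free_inj (row_base_free M)).
  by rewrite mulmxKpV ?fM // fx.
Qed.

Lemma codim_sub V (E S G : set V) n : subspace G -> G `<=` E ->
  codim E S n -> exists r, codim G S r.
Proof.
move=> sG GE [f [fL fS _]]; apply: (codim_ker sG (linear_onS GE fL)).
by move=> x /GE Ex; rewrite fS.
Qed.

Lemma codim_quo V (E S G : set V) n : subspace E -> subspace G ->
  S `<=` G -> G `<=` E -> codim E S n -> exists s, codim E G s.
Proof.
move=> sE sG SG GE [f [fL fS fs]].
have [M HM] := subspace_rowspace (subspace_image sG (linear_onS GE fL)).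
pose C := cokermx M; exists (\rank C), (fun x => f x *m col_base C); split.
- by move=> a x y Ex Ey; rewrite fL // mulmxDl scalemxAl.
- move=> x Ex; have -> : (f x *m col_base C = 0) <-> (f x <= M)%MS.
    rewrite submxE -[cokermx M]mulmx_base mulmxA.
    split=> [->|/eqP e]; first by rewrite mul0mx.
    by apply: (row_free_inj (row_base_free C)); rewrite e mul0mx.
  rewrite -HM; split=> [[y Gy fxy]|Gx]; last by exists x.
  rewrite -[x](subrK y); apply: subspaceD => //; apply: SG; apply/fS.
    by apply: subspaceB => //; exact: GE.
  by rewrite (linear_onB sE fL) ?fxy ?subrr //; exact: GE.
- move=> c; have /row_fullP[B HB] := col_base_full C.
  have [x Ex fx] := fs (c *m B); exists x => //.
  by rewrite fx -mulmxA HB mulmx1.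
Qed.

Lemma codim_trans V (E G S : set V) r s : subspace E -> subspace G ->
  subspace S -> S `<=` G -> G `<=` E ->
  codim G S r -> codim E G s -> codim E S (r + s).
Proof.
move=> sE sG sS SG GE [g [gL gS gs]] [f [fL fS fs]].
have [e [Ee fe]] := codim_basis fs.
pose h x := x - \sum_i f x 0 i *: e i.
have Es (c : 'I_s -> K) : E (\sum_i c i *: e i).
  by apply: subspace_sum => // i; exact: subspaceZ.
have hG x : E x -> G (h x).
  move=> Ex; apply/fS; first exact: subspaceB.
  rewrite (linear_onB sE fL) // (codim_coord _ sE fL) //.
  by apply/rowP=> i; rewrite !mxE subrr.
have hL : linear_on E h.
  move=> a x y Ex Ey; rewrite /h fL // scalerBr addrACA -opprD; congr (_ - _).
  rewrite scaler_sumr -big_split; apply: eq_bigr => i _ /=.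
  by rewrite !mxE scalerDl scalerA.
have hid x : E x -> f x = 0 -> h x = x.
  by move=> Ex fx; rewrite /h fx big1 ?subr0 // => i _; rewrite mxE scale0r.
exists (fun x => row_mx (g (h x)) (f x)); split.
- move=> a x y Ex Ey; rewrite hL // (gL _ _ _ (hG _ Ex) (hG _ Ey)) fL //.
  by rewrite scale_row_mx add_row_mx.
- move=> x Ex; split=> [|Sx].
    rewrite -[0](@row_mx0 _ 1 r s) => /eq_row_mx[g0 f0].
    by move: g0; rewrite hid // => /gS; apply; apply/fS.
  have f0 : f x = 0 by apply/fS => //; exact: SG.
  rewrite hid // f0 (_ : g x = 0) ?row_mx0 //.
  by apply/gS => //; exact: SG.
- move=> c; have [y Gy gy] := gs (lsubmx c).
  pose x := y + \sum_i rsubmx c 0 i *: e i.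
  have Ex : E x by apply: subspaceD => //; exact: GE.
  have fy : f y = 0 by apply/fS => //; exact: GE.
  have fx : f x = rsubmx c.
    have := fL 1 y _ (GE y Gy) (Es (rsubmx c 0)).
    rewrite scale1r fy scaler0 add0r (codim_coord _ sE fL) // => ->.
    by apply/rowP=> i; rewrite mxE.
  exists x => //; rewrite fx /h fx /x addrK gy hsubmxK //.
Qed.

(** A linear map which is injective modulo [S] and surjective modulo [S']
    induces an isomorphism of the quotients; surjectivity modulo [S'] makes this
    cover the second isomorphism theorem, with [h] the identity. *)
Lemma codim_pull V W (E S : set V) (E' S' : set W) (h : V -> W) n :
  subspace E -> subspace E' -> linear_on E h ->
  (forall x, E x -> E' (h x)) -> (forall x, E x -> (S x <-> S' (h x))) ->
  (forall y, E' y -> exists2 x, E x & S' (y - h x)) ->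
  codim E' S' n -> codim E S n.
Proof.
move=> sE sE' hL hE hS hs [f [fL fS fs]]; exists (f \o h); split=> /=.
- by move=> a x y Ex Ey /=; rewrite hL // fL //; exact: hE.
- by move=> x Ex; rewrite hS //; apply: fS; exact: hE.
- move=> c; have [y Ey fy] := fs c; have [x Ex Sx] := hs y Ey; exists x => //.
  have Ed : E' (y - h x) by apply: subspaceB => //; exact: hE.
  have := (fS _ Ed).2 Sx; rewrite (linear_onB sE' fL) //; last exact: hE.
  by move/eqP; rewrite subr_eq0 fy eq_sym => /eqP.
Qed.

Lemma codim_image V W (E S : set V) (h : V -> W) n :
  subspace E -> subspace S -> S `<=` E -> linear_on E h ->
  (forall x, E x -> h x = 0 -> x = 0) ->
  codim E S n -> codim (h @` E) (h @` S) n.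
Proof.
move=> sE sS SE hL hi.
have inj x y : E x -> E y -> h x = h y -> x = y.
  move=> Ex Ey /eqP; rewrite -subr_eq0 -(linear_onB sE hL) // => /eqP.
  by move/(hi _ (subspaceB sE Ex Ey))/eqP; rewrite subr_eq0 => /eqP.
have /choice[g gP] : forall y : W, exists x, (h @` E) y -> E x /\ h x = y.
  move=> y; have [[x Ex <-]|nE] := pselect ((h @` E) y); first by exists x.
  by exists 0.
have gE x : E x -> g (h x) = x.
  by move=> Ex; have [] := gP (h x) (imageP h Ex) => Eg /inj; exact.
apply: (codim_pull (E' := E) (S' := S) (h := g)) => //.
- exact: subspace_image.
- move=> a _ _ [x Ex <-] [y Ey <-]; rewrite -hL // !gE //.
  by case: sE => _; exact.
- by move=> _ [x Ex <-]; rewrite gE.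
- move=> _ [x Ex <-]; rewrite gE //; split=> [[y Sy]|Sx]; last by exists x.
  by move/(inj _ _ (SE _ Sy) Ex) <-.
- by move=> y Ey; exists (h y); [exists y | rewrite gE // subrr; case: sS].
Qed.

End Codim.

(** * Algebraic index theory *)

(** The index as a relative dimension: once [T] is injective on a subspace [D0]
    of finite codimension, the index is the codimension of [D0] minus that of
    [T D0].  Since [D0] may be shrunk, operators that agree on a subspace of
    finite codimension visibly have the same index. *)
Definition fredholm_index (K : fieldType) (V : lmodType K) (D E : set V)
    (T : V -> V) (n : int) :=
  exists (D0 : set V) (a b : nat),
    [/\ subspace D0, D0 `<=` D & forall x, D0 x -> T x = 0 -> x = 0] /\
    [/\ codim D D0 a, codim E (T @` D0) b & n = a%:Z - b%:Z].

(** The image is finite-dimensional exactly if the kernel contains the kernel of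
    a map to row vectors; this form is stable under sums and under composition
    on either side. *)
Definition finite_rank (K : fieldType) (V W : lmodType K) (G : V -> W) :=
  linear G /\ exists (n : nat) (f : V -> 'rV[K]_n), linear f /\
    forall x, f x = 0 -> G x = 0.

Section Index.
Variables (K : fieldType) (V : lmodType K).
Implicit Types (D E : set V) (T S B G : V -> V).

Lemma lin0 (W : lmodType K) (f : V -> W) : linear f -> f 0 = 0.
Proof.
by move=> fL; exact: (linear_on0 (@subspaceT _ _) (linear_linear_on fL)).
Qed.

Lemma linB (W : lmodType K) (f : V -> W) x y : linear f ->
  f (x - y) = f x - f y.
Proof. by move=> fL; rewrite addrC -scaleN1r fL scaleN1r addrC. Qed.

Lemma linD (W : lmodType K) (f : V -> W) x y : linear f ->
  f (x + y) = f x + f y.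
Proof. by move=> fL; have := fL 1 x y; rewrite !scale1r. Qed.

Lemma linZ (W : lmodType K) (f : V -> W) a x : linear f ->
  f (a *: x) = a *: f x.
Proof. by move=> fL; have := fL a x 0; rewrite (lin0 fL) !addr0. Qed.

Lemma lin_sum (W : lmodType K) (f : V -> W) n (F : 'I_n -> V) : linear f ->
  f (\sum_i F i) = \sum_i f (F i).
Proof.
move=> fL; elim/big_rec2: _ => [|i y x _ <-]; first exact: lin0.
exact: linD.
Qed.

Lemma linear_comp (W X : lmodType K) (f : V -> W) (g : W -> X) :
  linear f -> linear g -> linear (g \o f).
Proof. by move=> fL gL a x y /=; rewrite fL gL. Qed.

Lemma subspace_img D T : subspace D -> linear T -> subspace (T @` D).
Proof. by move=> sD TL; exact: (subspace_image sD (linear_linear_on TL)). Qed.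

Lemma subspace_ker (W : lmodType K) D (f : V -> W) : subspace D -> linear f ->
  subspace [set x | D x /\ f x = 0].
Proof.
move=> sD fL.
exact: (subspace_preim sD (linear_linear_on fL) (@subspace0 _ W)).
Qed.

(** Let [G = D0 + ker T].  Then [D / D0] splits into [G / D0], a copy of the
    kernel, and [D / G]; and [E / T D0] splits into [T D / T D0], another copy
    of [D / G], and the cokernel.  The two copies of [D / G] cancel. *)
Lemma fredholm_index_kernel D E T n : subspace D -> subspace E -> linear T ->
  (forall x, D x -> E (T x)) -> fredholm_index D E T n ->
  exists a b : nat, [/\ codim [set x | D x /\ T x = 0] [set 0] a,
    codim E (T @` D) b & n = a%:Z - b%:Z].
Proof.
move=> sD sE TL DE [D0 [a [b [[sD0 D0D Ti] [Da Eb ->]]]]].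
pose G := [set x | D x /\ (T @` D0) (T x)].
have sT0 := subspace_img sD0 TL.
have sTD := subspace_img sD TL.
have sG : subspace G by exact: (subspace_preim sD (linear_linear_on TL) sT0).
have D0G : D0 `<=` G by move=> x D0x; split; [exact: D0D | exists x].
have GD : G `<=` D by move=> x [].
have T0D : T @` D0 `<=` T @` D by move=> _ [x /D0D Dx <-]; exists x.
have TDE : T @` D `<=` E by move=> _ [x Dx <-]; exact: DE.
have [r Gr] := codim_sub sG GD Da.
have [s Ds] := codim_quo sD sG D0G GD Da.
have [t Tt] := codim_sub sTD TDE Eb.
have [u Tu] := codim_quo sE sTD T0D TDE Eb.
have ars := codim_uniq sD Da (codim_trans sD sG sD0 D0G GD Gr Ds).
have btu := codim_uniq sE Eb (codim_trans sE sTD sT0 T0D TDE Tt Tu).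
have Dt : codim D G t.
  apply: (codim_pull sD sTD (linear_linear_on TL) _ _ _ Tt).
  - by move=> x Dx; exists x.
  - by move=> x Dx; split=> [[]//|]; split.
  - by move=> _ [x Dx <-]; exists x => //; rewrite subrr; case: sT0.
have st := codim_uniq sD Ds Dt.
exists r, u; split=> //; last by lia.
apply: (codim_pull (h := id) (subspace_ker sD TL) sG _ _ _ _ Gr).
- by [].
- by move=> x [Dx Tx]; split=> //; rewrite Tx; case: sT0.
- move=> x [Dx Tx]; split=> [->|D0x]; first by case: sD0.
  exact: Ti.
- move=> y [Dy [z D0z Tz]]; exists (y - z); last by rewrite opprB addrC subrK.
  split; last by rewrite linB // Tz subrr.
  by apply: subspaceB => //; exact: D0D.
Qed.

Lemma fredholm_index_uniq D E T m n : subspace D -> subspace E -> linear T ->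
  (forall x, D x -> E (T x)) -> fredholm_index D E T m ->
  fredholm_index D E T n -> m = n.
Proof.
move=> sD sE TL DE Tm Tn.
have [a [b [ka Eb ->]]] := fredholm_index_kernel sD sE TL DE Tm.
have [c [d [kc Ed ->]]] := fredholm_index_kernel sD sE TL DE Tn.
by rewrite (codim_uniq (subspace_ker sD TL) ka kc) (codim_uniq sE Eb Ed).
Qed.

(** The composite is injective on the part [D1] of [D0] that [T] sends into
    [E0], and all codimensions are compared through [T D1], which lies in both
    [T D0] and [E0]. *)
Lemma fredholm_index_comp D E F T S m n :
  subspace D -> subspace E -> subspace F -> linear T -> linear S ->
  (forall x, D x -> E (T x)) -> (forall x, E x -> F (S x)) ->
  fredholm_index D E T m -> fredholm_index E F S n ->
  fredholm_index D F (S \o T) (m + n).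
Proof.
move=> sD sE sF TL SL DE EF [D0 [a [b [[sD0 D0D Ti] [Da Eb ->]]]]].
move=> [E0 [c [d [[sE0 E0E Si] [Ec Fd ->]]]]].
pose D1 := [set x | D0 x /\ E0 (T x)].
have sD1 : subspace D1 by exact: (subspace_preim sD0 (linear_linear_on TL)).
have D10 : D1 `<=` D0 by move=> x [].
have T10 : T @` D1 `<=` E0 by move=> _ [x [_ Ex] <-].
have [u D01] : exists u, codim D0 D1 u.
  have [g [gL gS _]] := Ec; apply: (codim_ker sD0 (f := g \o T)).
    move=> k x y /D0D/DE Ex /D0D/DE Ey /=; rewrite TL; exact: gL.
  move=> x D0x; rewrite /= gS; last by exact/DE/D0D.
  by split=> [[]//|]; split.
have TT : T @` D1 `<=` T @` D0 by move=> _ [x /D10 Dx <-]; exists x.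
have T0E : T @` D0 `<=` E by move=> _ [x /D0D Dx <-]; exact: DE.
have sT0 := subspace_img sD0 TL; have sT1 := subspace_img sD1 TL.
have T01 := codim_image sD0 sD1 D10 (linear_linear_on TL) Ti D01.
have ET1 := codim_trans sE sT0 sT1 TT T0E T01 Eb.
have [w Ew] := codim_sub sE0 E0E ET1.
have ew := codim_uniq sE ET1 (codim_trans sE sE0 sT1 T10 E0E Ew Ec).
have Sw := codim_image sE0 sT1 T10 (linear_linear_on SL) Si Ew.
have Fw : codim F (S @` (T @` D1)) (w + d)%N.
  apply: (codim_trans sF (subspace_img sE0 SL) (subspace_img sT1 SL) _ _ Sw Fd).
  - by move=> _ [x /T10 Ex <-]; exists x.
  - by move=> _ [x /E0E Ex <-]; exact: EF.
exists D1, (u + a)%N, (w + d)%N; split; split=> //.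
- by move=> x /D10 /D0D.
- by move=> x [D0x Ex] /= STx; apply: Ti => //; exact: Si.
- exact: (codim_trans sD sD0 sD1 D10 D0D D01 Da).
- by rewrite image_comp in Fw.
- by lia.
Qed.

Lemma codim_cut_ker D n (f : V -> 'rV[K]_n) : subspace D -> linear f ->
  exists r, codim D [set x | D x /\ f x = 0] r.
Proof.
move=> sD fL; apply: (codim_ker sD (linear_linear_on fL)) => x Dx.
by split=> [[]//|]; split.
Qed.

(** On the kernel of the finite rank part, [T] coincides with a bijection. *)
Lemma fredholm_index_bij D E T B G :
  subspace D -> subspace E -> linear B -> finite_rank G ->
  (forall x, D x -> B x = 0 -> x = 0) -> B @` D = E ->
  (forall x, D x -> T x = B x + G x) -> fredholm_index D E T 0.
Proof.
move=> sD sE BL [GL [n [f [fL fG]]]] Bi BE TBG.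
have [r Dr] := codim_cut_ker sD fL; set D0 := [set x | _] in Dr.
have sD0 : subspace D0 by exact: subspace_ker.
have TB x : D0 x -> T x = B x by move=> [Dx fx]; rewrite TBG // fG ?addr0.
have D0D : D0 `<=` D by move=> x [].
exists D0, r, r; split; split=> //; last by rewrite subrr.
- by move=> x D0x; rewrite TB //; apply: Bi; exact: D0D.
- rewrite (_ : T @` D0 = B @` D0) -?BE.
    exact: (codim_image sD sD0 D0D (linear_linear_on BL) Bi Dr).
  by apply: eq_imagel => x; exact: TB.
Qed.

Lemma finite_rank0 (W : lmodType K) : finite_rank (fun _ : V => 0 : W).
Proof.
have L0 (U : lmodType K) : linear (fun _ : V => 0 : U).
  by move=> a x y; rewrite scaler0 addr0.
by split; [exact: L0 | exists 0, (fun=> 0); split; [exact: L0 |]].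
Qed.

Lemma fredholm_index_iso D E B : subspace D -> subspace E -> linear B ->
  (forall x, D x -> B x = 0 -> x = 0) -> B @` D = E -> fredholm_index D E B 0.
Proof.
move=> sD sE BL Bi BE.
apply: (fredholm_index_bij sD sE BL (finite_rank0 V)) => // x.
by rewrite addr0.
Qed.

(** [S T = B + G] makes [T] injective on the kernel [D0] of [G].  The image of
    [D0] has finite codimension, because it contains [T S y = B' y] for all [y]
    in the kernel of [G'] with [S y] in [D0]. *)
Lemma fredholm_exists D E T S B G B' G' :
  subspace D -> subspace E -> linear T -> linear S ->
  (forall x, D x -> E (T x)) -> (forall y, E y -> D (S y)) ->
  linear B -> finite_rank G -> (forall x, D x -> B x = 0 -> x = 0) ->
  (forall x, D x -> S (T x) = B x + G x) ->
  linear B' -> finite_rank G' -> (forall x, E x -> B' x = 0 -> x = 0) ->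
  B' @` E = E -> (forall x, E x -> T (S x) = B' x + G' x) ->
  exists n, fredholm_index D E T n.
Proof.
move=> sD sE TL SL DE ED BL [GL [n [f [fL fG]]]] Bi STB.
move=> BL' [GL' [n' [f' [fL' fG']]]] Bi' BE' TSB.
have [r Dr] := codim_cut_ker sD fL; set D0 := [set x | _] in Dr.
have sD0 : subspace D0 by exact: subspace_ker.
pose g x := row_mx (f' x) (f (S x)).
have gL : linear g.
  by move=> a x y; rewrite /g fL' SL fL scale_row_mx add_row_mx.
have [s Es] := codim_cut_ker sE gL; set E0 := [set x | _] in Es.
have sE0 : subspace E0 by exact: subspace_ker.
have E0E : E0 `<=` E by move=> x [].
have Bs := codim_image sE sE0 E0E (linear_linear_on BL') Bi' Es.
rewrite BE' in Bs.
have [||b Eb] := codim_quo sE (subspace_img sD0 TL) _ _ Bs.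
- move=> _ [y [Ey gy] <-].
  move: gy; rewrite /g -[0](@row_mx0 _ 1 n' n) => /eq_row_mx[fy' fy].
  exists (S y); first by split=> //; exact: ED.
  by rewrite TSB // fG' // addr0.
- by move=> _ [x [Dx _] <-]; exact: DE.
exists (r%:Z - b%:Z), D0, r, b; split; split=> //; first by move=> x [].
move=> x [Dx fx] Tx; apply: Bi => //.
by have := STB x Dx; rewrite Tx (lin0 SL) fG // addr0.
Qed.

(** [P1] and [P2] are the projections of both decompositions [D = D1 + D2] and
    [E = E1 + E2], and [T] is the direct sum of [T1] and [T2]. *)
Lemma fredholm_index_sum D E D1 D2 E1 E2 T T1 T2 P1 P2 m n :
  subspace D -> linear T -> linear T1 -> linear T2 ->
  linear P1 -> linear P2 ->
  (forall x, D1 x -> E1 (T1 x)) -> (forall x, D2 x -> E2 (T2 x)) ->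
  (forall x, D x -> D1 (P1 x) /\ D2 (P2 x)) ->
  (forall x, E x -> E1 (P1 x) /\ E2 (P2 x)) ->
  (forall x, D1 x \/ E1 x -> P1 x = x /\ P2 x = 0) ->
  (forall x, D2 x \/ E2 x -> P1 x = 0 /\ P2 x = x) ->
  (forall x, D x \/ E x -> P1 x + P2 x = x) ->
  D1 `<=` D -> D2 `<=` D -> E1 `<=` E -> E2 `<=` E -> subspace E ->
  (forall x, D x -> T x = T1 (P1 x) + T2 (P2 x)) ->
  fredholm_index D1 E1 T1 m -> fredholm_index D2 E2 T2 n ->
  fredholm_index D E T (m + n).
Proof.
move=> sD TL TL1 TL2 PL1 PL2 DE1 DE2 DP EP P1E P2E PD D1D D2D E1E E2E sE TT.
move=> [D01 [a1 [b1 [[s1 S1 i1] [[f1 [fL1 fS1 fs1]] [g1 [gL1 gS1 gs1]] ->]]]]].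
move=> [D02 [a2 [b2 [[s2 S2 i2] [[f2 [fL2 fS2 fs2]] [g2 [gL2 gS2 gs2]] ->]]]]].
pose D0 := [set x | D x /\ D01 (P1 x) /\ D02 (P2 x)].
have sum1 x y : D1 x \/ E1 x -> D2 y \/ E2 y ->
    P1 (x + y) = x /\ P2 (x + y) = y.
  move=> /P1E[x1 x2] /P2E[y1 y2]; rewrite !linD //.
  by rewrite x1 x2 y1 y2 addr0 add0r.
exists D0, (a1 + a2)%N, (b1 + b2)%N; split; split.
- split.
    by split; [case: sD | rewrite !lin0 //; split; [case: s1 | case: s2]].
  move=> a x y [Dx [x1 x2]] [Dy [y1 y2]]; split; first by case: sD => _; exact.
  by rewrite PL1 PL2; split; [case: s1 => _; exact | case: s2 => _; exact].
- by move=> x [].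
- move=> x [Dx [x1 x2]] Tx; rewrite -[x]PD; last by left.
  move: Tx; rewrite TT // => Tx.
  have [Q1 Q2] : P1 (T1 (P1 x) + T2 (P2 x)) = T1 (P1 x) /\
      P2 (T1 (P1 x) + T2 (P2 x)) = T2 (P2 x).
    by apply: sum1; right; [apply: DE1; exact: S1 | apply: DE2; exact: S2].
  rewrite Tx !lin0 // in Q1 Q2.
  by rewrite (i1 _ x1) // (i2 _ x2) // addr0.
- exists (fun x => row_mx (f1 (P1 x)) (f2 (P2 x))); split.
  + move=> a x y /DP[x1 x2] /DP[y1 y2]; rewrite PL1 PL2 fL1 // fL2 //.
    by rewrite scale_row_mx add_row_mx.
  + move=> x Dx; have [x1 x2] := DP x Dx.
    rewrite -[0](@row_mx0 _ 1 a1 a2); split=> [/eq_row_mx[/fS1 H1 /fS2 H2]|].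
      by split=> //; split; [exact: H1 | exact: H2].
    by move=> [_ [/(fS1 _ x1).2 -> /(fS2 _ x2).2 ->]].
  + move=> c; have [x x1 fx] := fs1 (lsubmx c).
    have [y y2 fy] := fs2 (rsubmx c).
    have [Px Py] := sum1 _ _ (or_introl x1) (or_introl y2).
    exists (x + y); last by rewrite Px Py fx fy hsubmxK.
    by apply: subspaceD => //; [exact: D1D | exact: D2D].
- exists (fun x => row_mx (g1 (P1 x)) (g2 (P2 x))); split.
  + move=> a x y /EP[x1 x2] /EP[y1 y2]; rewrite PL1 PL2 gL1 // gL2 //.
    by rewrite scale_row_mx add_row_mx.
  + move=> x Ex; have [x1 x2] := EP x Ex.
    rewrite -[0](@row_mx0 _ 1 b1 b2); split.
      move=> /eq_row_mx[/(gS1 _ x1).1[u u1 Tu] /(gS2 _ x2).1[v v2 Tv]].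
      have [Pu Pv] := sum1 _ _ (or_introl (S1 _ u1)) (or_introl (S2 _ v2)).
      have Duv : D (u + v).
        by apply: subspaceD => //; [exact/D1D/S1 | exact/D2D/S2].
      exists (u + v); first by split=> //; rewrite Pu Pv.
      by rewrite TT // Pu Pv Tu Tv PD //; right.
    move=> [u [Du [u1 u2]]]; rewrite TT // => Tu.
    have [] :=
      sum1 _ _ (or_intror (DE1 _ (S1 _ u1))) (or_intror (DE2 _ (S2 _ u2))).
    rewrite Tu => Q1 Q2.
    rewrite (gS1 _ x1).2; last by exists (P1 u).
    by rewrite (gS2 _ x2).2 //; exists (P2 u).
  + move=> c; have [x x1 fx] := gs1 (lsubmx c).
    have [y y2 fy] := gs2 (rsubmx c).
    have [Px Py] := sum1 _ _ (or_intror x1) (or_intror y2).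
    exists (x + y); last by rewrite Px Py fx fy hsubmxK.
    by apply: subspaceD => //; [exact: E1E | exact: E2E].
- by lia.
Qed.

End Index.

(** * Complete norms and idempotents in Banach rings *)

(** Homogeneity is not part of this notion, so that the vectors of a Hilbert
    space, the elements of a C*-algebra and matrices over it, whose scalars
    differ, fall under the same fixed point theorem. *)
Record is_complete_norm (R : realType) (V : zmodType) (N : V -> R) : Prop := {
  complete_normB : forall x y, N (x - y) <= N x + N y;
  complete_norm0 : N 0 = 0;
  complete_norm0_eq : forall x, N x = 0 -> x = 0;
  complete_norm_lim : forall u : nat -> V,
    (forall e : R, 0 < e -> exists M : nat, forall m n : nat,
       (M <= m)%N -> (M <= n)%N -> N (u m - u n) < e) ->
    exists l, forall e : R, 0 < e -> exists M : nat, forall n : nat,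
       (M <= n)%N -> N (u n - l) < e
}.

Section Norm.
Variables (R : realType) (V : zmodType) (N : V -> R).
Hypothesis NV : is_complete_norm N.

Lemma complete_normN_le x : N (- x) <= N x.
Proof.
by have := complete_normB NV 0 x; rewrite sub0r (complete_norm0 NV) add0r.
Qed.

Lemma complete_normN x : N (- x) = N x.
Proof.
by apply/eqP; rewrite eq_le complete_normN_le -{1}[x]opprK complete_normN_le.
Qed.

Lemma complete_normD x y : N (x + y) <= N x + N y.
Proof. by have := complete_normB NV x (- y); rewrite opprK complete_normN. Qed.

Lemma complete_norm_sym x y : N (x - y) = N (y - x).
Proof. by rewrite -complete_normN opprB. Qed.

Lemma complete_norm_ge0 x : 0 <= N x.
Proof.
by have := complete_normB NV x x; rewrite subrr (complete_norm0 NV); lra.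
Qed.

Lemma complete_norm_eq0 x : (forall e, 0 < e -> N x <= e) -> x = 0.
Proof.
move=> H; apply: (complete_norm0_eq NV); apply/eqP.
rewrite eq_le complete_norm_ge0 andbT.
by apply/ler_addgt0Pr => e /H; rewrite add0r.
Qed.

Lemma complete_norm_triangle y x z : N (x - z) <= N (x - y) + N (y - z).
Proof. by have := complete_normD (x - y) (y - z); rewrite addrA subrK. Qed.

Lemma half_pow_small (c e : R) : 0 <= c -> 0 < e ->
  exists M : nat, c / 2 ^+ M < e.
Proof.
move=> c0 e0; exists (Num.bound (c / e)).
rewrite ltr_pdivrMr ?exprn_gt0 // mulrC -ltr_pdivrMr //.
have : c / e < (Num.bound (c / e))%:R.
  by rewrite archi_boundP // divr_ge0 // ltW.
move/lt_le_trans; apply; rewrite -natrX ler_nat ltnW //; exact: ltn_expl.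
Qed.

(** The Banach fixed point theorem for an invariant closed set [Q], started at
    0.  The set [Q] carries what must survive in the limit: a bound on the norm,
    or a commutation property. *)
Lemma contraction_fixpoint (f : V -> V) (Q : V -> Prop) :
  Q 0 -> (forall x, Q x -> Q (f x)) ->
  (forall x, (forall e, 0 < e -> exists2 y, Q y & N (x - y) <= e) -> Q x) ->
  (forall x y, Q x -> Q y -> N (f x - f y) <= N (x - y) / 2) ->
  exists x, [/\ f x = x, Q x & N x <= 2 * N (f 0)].
Proof.
move=> Q0 Qf Qc fc; pose u n := iter n f 0; pose c := N (f 0).
have c0 : 0 <= c by exact: complete_norm_ge0.
have Qu n : Q (u n) by elim: n => //= n; exact: Qf.
have step n : N (u n.+1 - u n) <= c / 2 ^+ n.
  elim: n => [|n IH]; first by rewrite subr0 expr0 divr1.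
  apply: le_trans (fc _ _ (Qu n.+1) (Qu n)) _.
  by rewrite exprSr invfM mulrA ler_pM2r // invr_gt0.
have far n m : N (u (n + m)%N - u n) <= 2 * c / 2 ^+ n.
  suff : N (u (n + m)%N - u n) <= 2 * c / 2 ^+ n - 2 * c / 2 ^+ (n + m).
    move/le_trans; apply; rewrite gerBl divr_ge0 ?exprn_ge0 ?mulr_ge0 //.
  elim: m => [|m IH]; first by rewrite addn0 !subrr (complete_norm0 NV).
  apply: le_trans (complete_norm_triangle (u (n + m)%N) _ _) _; rewrite addnS.
  have := step (n + m)%N; move: IH; rewrite exprSr invfM.
  by set a := N _; set b := N _; lra.
have [l ul] : exists l, forall e : R, 0 < e -> exists M : nat, forall n : nat,
    (M <= n)%N -> N (u n - l) < e.
  apply: (complete_norm_lim NV) => e e0.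
  have c4 : 0 <= 4 * c by rewrite mulr_ge0.
  have [M cM] := half_pow_small c4 e0.
  exists M => m n /subnKC <- /subnKC <-.
  apply: le_lt_trans (complete_norm_triangle (u M) _ _) _.
  rewrite [X in _ + X]complete_norm_sym; apply: le_lt_trans cM.
  have := far M (m - M)%N; have := far M (n - M)%N.
  rewrite -!mulrA; move: (c / 2 ^+ M) (N _) (N _) => v a b; lra.
have Ql : Q l.
  apply: Qc => e e0; have [M Hu] := ul e e0; exists (u M) => //.
  by rewrite complete_norm_sym ltW // Hu.
exists l; split=> //.
  apply/eqP; rewrite -subr_eq0; apply/eqP/complete_norm_eq0 => e e0.
  have e2 : 0 < e / 2 by rewrite divr_gt0.
  have [M Hu] := ul _ e2.
  apply: le_trans (complete_norm_triangle (f (u M)) _ _) _.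
  have := fc l (u M) Ql (Qu M); rewrite [X in _ <= X / 2]complete_norm_sym.
  have := Hu M (leqnn _); have := Hu M.+1 (leqnSn _); rewrite /=; lra.
apply/ler_addgt0Pr => e e0; have [M Hu] := ul e e0.
have := complete_norm_triangle (u M) l 0; rewrite !subr0 => /le_trans; apply.
have := far 0%N M; rewrite add0n expr0 divr1 subr0 => Hm.
by have := Hu M (leqnn _); rewrite complete_norm_sym -/c; lra.
Qed.

End Norm.

Section Coordinates.
Variables (R : realType) (V W : zmodType) (I : finType) (N : V -> R).
Variables (co : W -> I -> V) (mk : (I -> V) -> W).
Hypothesis NV : is_complete_norm N.
Hypothesis mkK : forall g i, co (mk g) i = g i.
Hypothesis coB : forall x y i, co (x - y) i = co x i - co y i.
Hypothesis co_inj : forall x, (forall i, co x i = 0) -> x = 0.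

(** The coordinates [co] are those of a vector in the k-fold sum of a Hilbert
    space, or the entries of a square matrix over a C*-algebra. *)
Lemma coordinatewise_complete :
  is_complete_norm (fun w : W => \sum_i N (co w i)).
Proof.
have Nge0 := complete_norm_ge0 NV.
have co0 i : co 0 i = 0 by have := coB 0 0 i; rewrite !subrr.
have co_le w i : N (co w i) <= \sum_j N (co w j).
  by rewrite (bigD1 i) //= lerDl sumr_ge0.
split.
- move=> x y; rewrite -big_split ler_sum //= => i _.
  by rewrite coB (complete_normB NV).
- by rewrite big1 // => i _; rewrite co0 (complete_norm0 NV).
- move=> x /eqP; rewrite psumr_eq0 // => /allP x0; apply: co_inj => i.
  by apply: (complete_norm0_eq NV); apply/eqP; have := x0 i (mem_index_enum i).
- move=> u uc.
  have /choice[l ul] : forall i, exists l : V, forall e : R, 0 < e ->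
      exists M : nat, forall n : nat, (M <= n)%N -> N (co (u n) i - l) < e.
    move=> i; apply: (complete_norm_lim NV) => e /uc[M HM].
    exists M => m n Mm Mn.
    by rewrite -coB; apply: le_lt_trans (co_le _ i) _; exact: HM.
  exists (mk l) => e e0; pose e' := e / (#|I|.+1)%:R.
  have e'0 : 0 < e' by rewrite divr_gt0.
  have /choice[M HM] : forall i, exists M : nat, forall n : nat, (M <= n)%N ->
      N (co (u n) i - l i) < e' by move=> i; exact: ul.
  exists (\max_i M i) => n /bigmax_leqP Mn.
  apply: (@le_lt_trans _ _ (\sum_(i : I) e')).
    by apply: ler_sum => i _; rewrite coB mkK ltW // HM // Mn.
  rewrite sumr_const -mulr_natr /e' mulrAC ltr_pdivrMr //.
  by rewrite ltr_pM2l // ltr_nat.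
Qed.

End Coordinates.

Section BanachRing.
Variables (R : realType) (B : pzRingType) (N : B -> R).
Hypothesis NB : is_complete_norm N.
Hypothesis NM : forall x y, N (x * y) <= N x * N y.

Lemma neumann (x : B) : N x <= 1 / 2 ->
  exists y, (1 - x) * y = 1 /\ y * (1 - x) = 1.
Proof.
move=> Nx; have N0 := complete_norm_ge0 NB.
have half y : N (x * y) <= N y / 2.
  by apply: le_trans (NM _ _) _; rewrite mulrC ler_wpM2l //; lra.
have half' y : N (y * x) <= N y / 2.
  by apply: le_trans (NM _ _) _; rewrite ler_wpM2l //; lra.
have [||||y [yE _ _]] := @contraction_fixpoint _ _ _ NB
    (fun y => 1 + x * y) (fun=> True) => //.
  by move=> y z _ _ /=; rewrite opprD addrACA subrr add0r -mulrBr half.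
have [||||z [zE _ _]] := @contraction_fixpoint _ _ _ NB
    (fun y => 1 + y * x) (fun=> True) => //.
  by move=> z w _ _ /=; rewrite opprD addrACA subrr add0r -mulrBl half'.
have ry : (1 - x) * y = 1 by rewrite mulrBl mul1r -{1}yE addrK.
have lz : z * (1 - x) = 1 by rewrite mulrBr mulr1 -{1}zE addrK.
exists y; split=> //.
by have : z = y; [rewrite -[z]mulr1 -ry mulrA lz mul1r | move=> <-].
Qed.

(** Murray-von Neumann equivalence of idempotents, with similarity in the place
    of partial isometries.  Replacing [x] by [q x p] and [y] by [p y q] gives
    the last two conditions for free. *)
Definition alg_equiv (p q : B) :=
  exists x y, [/\ y * x = p, x * y = q, q * x = x /\ x * p = x
    & p * y = y /\ y * q = y].

(** [z = q p + (1 - q) (1 - p)] satisfies [q z = z p] and is close to 1, hence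
    invertible, so it conjugates [p] to [q]. *)
Lemma close_idempotents (p q : B) : p * p = p -> q * q = q ->
  (N q + N p) * N (q - p) <= 1 / 2 -> alg_equiv p q.
Proof.
move=> pp qq small; pose z := q * p + (1 - q) * (1 - p).
have zE : z = 1 - (q * (q - p) - (q - p) * p).
  rewrite /z !mulrBl !mulrBr !mulr1 !mul1r pp qq.
  by rewrite [in RHS]opprB -!addrA; exact: addrCA.
have [w [zw wz]] : exists w, z * w = 1 /\ w * z = 1.
  rewrite zE; apply: neumann; apply: le_trans small.
  apply: le_trans (complete_normB NB _ _) _.
  by rewrite [leRHS]mulrDl lerD ?NM // [leRHS]mulrC NM.
have qz : q * z = q * p.
  rewrite /z mulrDr !mulrA [q * (1 - q)]mulrBr qq mulr1 subrr mul0r.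
  by rewrite addr0.
have zp : z * p = q * p.
  by rewrite /z mulrDl -!mulrA [(1 - p) * p]mulrBl mul1r pp subrr mulr0 addr0.
exists (z * p), (p * w); split; last split.
- by rewrite -mulrA (mulrA w) wz mul1r pp.
- by rewrite -mulrA (mulrA p) pp mulrA zp -qz -mulrA zw mulr1.
- by rewrite zp mulrA qq; split=> //; rewrite -mulrA pp.
- by rewrite mulrA pp.
- have -> : p * w = w * q; last by rewrite -mulrA qq.
  by rewrite -[p * w]mul1r -wz -mulrA (mulrA z) zp -qz -mulrA zw mulr1.
Qed.

Lemma complete_normMn (x : B) n : N (x *+ n) <= N x *+ n.
Proof.
elim: n => [|n IH]; first by rewrite !mulr0n (complete_norm0 NB).
by rewrite !mulrS (le_trans (complete_normD NB _ _)) // lerD2l.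
Qed.

(** With [e = b b - b] and [c = 1 - 2 b] one has [c c = 1 + 4 e], and
    [b + c y], for [y] commuting with [b], is idempotent if and only if
    [c c (y - y y) = e].  This is a fixed point equation for [y], contracting on
    the ball of radius 1/8 when [e] is small; its solution is of the order of
    [e], and commutes with everything that commutes with [b] since all iterates
    do. *)
Lemma almost_idempotent (b : B) : N (b * b - b) <= 1 / 32 ->
  exists q, [/\ q * q = q, forall c, c * b = b * c -> c * q = q * c
    & N (q - b) <= (N 1 + 2 * N b) * (2 * N (b * b - b))].
Proof.
set e := b * b - b => Ne.
have N0 := complete_norm_ge0 NB; have NN := complete_normN NB.
have ND := complete_normD NB; have NBl := complete_normB NB.
pose f y := y * y + e - (e * (y - y * y)) *+ 4.
pose Q y := N y <= 1 / 8 /\ forall c, c * b = b * c -> c * y = y * c.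
have ce c : c * b = b * c -> c * e = e * c.
  by move=> cb; rewrite /e mulrBr mulrBl -cb !mulrA cb -!mulrA cb.
have Nsq y : N y <= 1 / 8 -> N (y * y) <= N y / 8.
  by move=> Ny; apply: le_trans (NM _ _) _; have := N0 y; nra.
have [||||y [fy [Ny cy] Ny']] := @contraction_fixpoint _ _ _ NB f Q.
- by split=> [|c _]; [rewrite (complete_norm0 NB); lra | rewrite mulr0 mul0r].
- move=> y [Ny cy]; split.
    have H1 := Nsq y Ny.
    have H2 : N ((e * (y - y * y)) *+ 4) <= N e * (N y + N (y * y)) * 4.
      rewrite mulr_natr; apply: le_trans (complete_normMn _ _) _.
      rewrite ler_pMn2r //; apply: le_trans (NM _ _) _.
      by rewrite ler_wpM2l ?N0 ?NBl.
    have := NBl (y * y + e) ((e * (y - y * y)) *+ 4); rewrite -/(f y).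
    have := ND (y * y) e; have := N0 y; have := N0 e; have := N0 (y * y).
    by move: H1 H2 Ny Ne; clear; nra.
  move=> c cb; have cyc := cy c cb; have cec := ce c cb.
  have cyy : c * (y * y) = y * y * c by rewrite mulrA cyc -!mulrA cyc.
  have cw : c * (y - y * y) = (y - y * y) * c by rewrite mulrBr mulrBl cyy cyc.
  have cew : c * (e * (y - y * y)) = e * (y - y * y) * c.
    by rewrite mulrA cec -!mulrA cw.
  rewrite /f [LHS]mulrBr [RHS]mulrBl; congr (_ - _).
    by rewrite mulrDr mulrDl cyy cec.
  by rewrite mulrnAr mulrnAl cew.
- move=> y H; split.
    apply/ler_addgt0Pr => d d0; have [z [Nz _] yz] := H d d0.
    by have := ND (y - z) z; rewrite subrK; lra.
  move=> c cb; apply/eqP; rewrite -subr_eq0.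
  apply/eqP/(complete_norm_eq0 NB) => d d0.
  have Nc := N0 c.
  have d' : 0 < d / (2 * (N c + 1)) by rewrite divr_gt0 //; lra.
  have [z [_ cz] yz] := H _ d'.
  have -> : c * y - y * c = c * (y - z) - (y - z) * c.
    by rewrite mulrBr mulrBl (cz c cb) opprB addrA subrK.
  apply: le_trans (NBl _ _) _.
  have H1 := NM c (y - z); have H2 := NM (y - z) c.
  move: yz; rewrite ler_pdivlMr; last by lra.
  by have := N0 (y - z); nra.
- move=> y z [Ny _] [Nz _].
  have -> : f y - f z =
      (y * y - z * z) - (e * ((y - z) - (y * y - z * z))) *+ 4.
    have subACA (s t u v : B) : s - t - (u - v) = s - u - (t - v).
      by rewrite [- (u - v)]opprD addrACA -opprD.
    rewrite /f subACA; congr (_ - _).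
      by rewrite opprD addrACA subrr addr0.
    by rewrite -mulrnBl -mulrBr subACA.
  have H1 : N (y * y - z * z) <= N (y - z) / 4.
    have -> : y * y - z * z = y * (y - z) + (y - z) * z.
      by rewrite mulrBr mulrBl addrA subrK.
    apply: le_trans (ND _ _) _.
    by have := NM y (y - z); have := NM (y - z) z; have := N0 (y - z); nra.
  have H2 : N ((e * ((y - z) - (y * y - z * z))) *+ 4) <=
      N e * (N (y - z) + N (y * y - z * z)) * 4.
    rewrite mulr_natr; apply: le_trans (complete_normMn _ _) _.
    rewrite ler_pMn2r //; apply: le_trans (NM _ _) _.
    by rewrite ler_wpM2l ?N0 ?NBl.
  apply: le_trans (NBl _ _) _.
  by have := N0 (y - z); have := N0 e; move: H1 H2 Ne; clear; nra.
have f0 : f 0 = e by rewrite /f mulr0 subr0 mulr0 mul0rn add0r subr0.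
have [c cE] : exists c, c = 1 - b *+ 2 by exists (1 - b *+ 2).
pose w := y - y * y.
have cb : c * b = b * c by rewrite cE mulrBl mulrBr mul1r mulr1 mulrnAl mulrnAr.
have by_ : b * y = y * b by exact: cy.
have ycy : c * y = y * c by exact: cy.
have cc : c * c = 1 + e *+ 4.
  rewrite -expr2 -sqrrN cE opprB sqrrB1 exprMn_n -mulrnA /e expr2 addrC.
  by rewrite mulrnBl.
have wE : w = e - (e * w) *+ 4.
  by rewrite {1}/w -{1}fy /f -/w addrAC [y * y + e]addrC addrK.
have ccw : c * c * w = e by rewrite cc mulrDl mul1r mulrnAl {1}wE subrK.
exists (b + c * y); split.
- apply/eqP; rewrite -subr_eq0; apply/eqP.
  have -> : (b + c * y) * (b + c * y) =
      b * b + (b * c * y) *+ 2 + c * c * (y * y).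
    rewrite mulrDl !mulrDr -!addrA; congr (_ + _).
    have -> : c * y * b = b * c * y by rewrite -mulrA -by_ mulrA cb.
    have -> : c * y * (c * y) = c * c * (y * y).
      by rewrite -!mulrA; congr (_ * _); rewrite mulrA -ycy mulrA.
    by rewrite [b * (c * y)]mulrA.
  have -> : c * c * (y * y) = c * c * y - e.
    by rewrite -[in RHS]ccw /w mulrBr opprB addrC subrK.
  have -> : c * c * y = c * y - (b * c * y) *+ 2.
    by rewrite {1}cE mulrBl mul1r mulrBl !mulrnAl.
  rewrite /e; set X := _ *+ 2; set Y := c * y.
  rewrite opprB [Y - X + _]addrC addrACA [b * b + _]addrC subrK.
  by rewrite [X + _]addrC subrK subrr.
- move=> d db; rewrite mulrDr mulrDl db; congr (_ + _).
  have dc : d * c = c * d.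
    by rewrite cE mulrBr mulrBl mulr1 mul1r mulrnAr mulrnAl db.
  by rewrite mulrA dc -!mulrA (cy d db).
- rewrite addrC addKr; apply: le_trans (NM _ _) _.
  have Nc : N c <= N 1 + 2 * N b.
    rewrite cE mulr_natl; apply: le_trans (NBl _ _) _.
    by rewrite lerD2l complete_normMn.
  rewrite f0 in Ny'.
  by apply: ler_pM.
Qed.

(** The element [b] is almost idempotent if it is close to [p], so
    [almost_idempotent] corrects it to an idempotent which is still close enough
    to [p] for [close_idempotents]. *)
Lemma idempotent_perturbation (p : B) : p * p = p ->
  exists2 d : R, 0 < d & forall b, N (b - p) <= d ->
    exists q, [/\ q * q = q, alg_equiv p q
      & forall c, c * b = b * c -> c * q = q * c].
Proof.
move=> pp; have N0 := complete_norm_ge0 NB; pose M := N 1 + N p + 1.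
have M1 : 1 <= M by rewrite /M; have := N0 1; have := N0 p; lra.
have M3_gt0 : 0 < 200 * M ^+ 3 by rewrite mulr_gt0 // exprn_gt0 //; lra.
(* For [N (b - p) <= d] the estimates below are [N (b b - b) <= 3 M d],
   [N (q - p) <= 19 M^2 d] and [N q + N p <= 3 M]; the two smallness
   conditions then hold for this [d]. *)
exists (1 / (200 * M ^+ 3)); first by rewrite divr_gt0.
move=> b; set d := 1 / _ => bp.
have Md : 200 * M ^+ 3 * d = 1.
  by rewrite /d mulrC divfK // gt_eqF.
have d0 : 0 < d by rewrite divr_gt0.
have M3 : M ^+ 3 * d = 1 / 200 by lra.
have M2 : M ^+ 2 * d <= 1 / 200.
  rewrite -M3 ler_pM2r //; rewrite !exprS expr0; nra.
have Md1 : M * d <= 1 / 200.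
  by apply: le_trans M2; rewrite ler_pM2r // expr2; nra.
have dd : d <= 1 / 200 by nra.
have Nb : N b <= M.
  rewrite -[b](subrK p) (le_trans (complete_normD NB _ _)) // /M.
  by have := N0 1; lra.
have Np : N p <= M by rewrite /M; have := N0 1; lra.
have Ne : N (b * b - b) <= 3 * (M * d).
  have -> : b * b - b = b * (b - p) + (b - p) * p - (b - p).
    by rewrite mulrBr mulrBl pp addrA subrK opprB addrA subrK.
  apply: le_trans (complete_normB NB _ _) _.
  have := complete_normD NB (b * (b - p)) ((b - p) * p).
  have := NM b (b - p); have := NM (b - p) p.
  have := N0 (b - p); have := N0 p; have := N0 b.
  by move: bp Nb Np M1; clear; nra.
have [|q [qq cq Nq]] := @almost_idempotent b; first by lra.
have Nqb : N (q - b) <= 18 * (M ^+ 2 * d).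
  apply: le_trans Nq _; have N1 : N 1 <= M by rewrite /M; have := N0 p; lra.
  have -> : 18 * (M ^+ 2 * d) = (3 * M) * (2 * (3 * (M * d))) by ring.
  by apply: ler_pM; rewrite ?addr_ge0 ?mulr_ge0 //; lra.
have Nqp : N (q - p) <= 19 * (M ^+ 2 * d).
  apply: le_trans (complete_norm_triangle NB b _ _) _.
  have : d <= M ^+ 2 * d by rewrite ler_peMl ?(ltW d0) // expr2; nra.
  by lra.
exists q; split=> //; apply: close_idempotents => //.
have Nq2 : N q <= 2 * M.
  by rewrite -[q](subrK p) (le_trans (complete_normD NB _ _)) //; lra.
apply: (@le_trans _ _ (3 * M * (19 * (M ^+ 2 * d)))).
  by apply: ler_pM; rewrite ?addr_ge0 //; lra.
have -> : 3 * M * (19 * (M ^+ 2 * d)) = 57 * (M ^+ 3 * d) by ring.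
by rewrite M3; lra.
Qed.

End BanachRing.

(** * Norm limits of finite rank operators *)

Section FiniteRank.
Variables (K : fieldType).
Implicit Types (U V W : lmodType K).

Lemma finite_rank_add V W (G1 G2 : V -> W) :
  finite_rank G1 -> finite_rank G2 -> finite_rank (fun x => G1 x + G2 x).
Proof.
move=> [L1 [n1 [f1 [fL1 f10]]]] [L2 [n2 [f2 [fL2 f20]]]]; split.
  by move=> a x y; rewrite L1 L2 scalerDr addrACA.
exists (n1 + n2)%N, (fun x => row_mx (f1 x) (f2 x)); split.
  by move=> a x y; rewrite fL1 fL2 scale_row_mx add_row_mx.
move=> x; rewrite -[0](@row_mx0 _ 1 n1 n2) => /eq_row_mx[/f10 -> /f20 ->].
by rewrite addr0.
Qed.

Lemma finite_rank_compl U V W (G : V -> W) (T : W -> U) :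
  linear T -> finite_rank G -> finite_rank (T \o G).
Proof.
move=> TL [L [n [f [fL f0]]]]; split; first exact: linear_comp.
by exists n, f; split=> // x /f0 /= ->; rewrite (lin0 TL).
Qed.

Lemma finite_rank_compr U V W (G : V -> W) (T : U -> V) :
  linear T -> finite_rank G -> finite_rank (G \o T).
Proof.
move=> TL [L [n [f [fL f0]]]]; split; first exact: linear_comp.
by exists n, (f \o T); split=> [|x /f0//]; exact: linear_comp.
Qed.

End FiniteRank.

Section Operators.
Variables (R : realType) (V : lmodType R[i]) (N : V -> R).
Hypothesis NV : is_complete_norm N.
Implicit Types (S T K Q : V -> V) (D E : set V).

Definition bounded_map T := linear T /\ exists C, forall x, N (T x) <= C * N x.

(** The norm closure of the finite rank operators.  It replaces the compact
    operators, because it is visibly an ideal of the bounded operators. *)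
Definition almost_finite_rank K := bounded_map K /\ forall e, 0 < e ->
  exists2 G : V -> V, finite_rank G & forall x, N (K x - G x) <= e * N x.

Lemma bounded_ge0 T : bounded_map T ->
  exists2 C, 0 < C & forall x, N (T x) <= C * N x.
Proof.
move=> [_ [C HC]]; exists (Num.max C 1); first by rewrite lt_max ltr01 orbT.
move=> x; apply: le_trans (HC x) _.
by rewrite ler_wpM2r ?(complete_norm_ge0 NV) // le_max lexx.
Qed.

Lemma bounded_id : bounded_map id.
Proof. by split=> //; exists 1 => x; rewrite mul1r. Qed.

Lemma bounded_comp S T : bounded_map S -> bounded_map T -> bounded_map (S \o T).
Proof.
move=> bS bT; have [C C0 HC] := bounded_ge0 bS.
have [C' _ HC'] := bounded_ge0 bT.
split; first by apply: linear_comp; [case: bT | case: bS].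
exists (C * C') => x /=; apply: le_trans (HC _) _.
by rewrite -mulrA ler_pM2l.
Qed.

Lemma bounded_add S T : bounded_map S -> bounded_map T ->
  bounded_map (fun x => S x + T x).
Proof.
move=> [SL [C HC]] [TL [C' HC']]; split.
  by move=> a x y; rewrite SL TL scalerDr addrACA.
exists (C + C') => x; rewrite mulrDl (le_trans (complete_normD NV _ _)) //.
by rewrite lerD.
Qed.

Lemma almost_finite_rank_add K1 K2 : almost_finite_rank K1 ->
  almost_finite_rank K2 -> almost_finite_rank (fun x => K1 x + K2 x).
Proof.
move=> [b1 H1] [b2 H2]; split; first exact: bounded_add.
move=> e e0; have e2 : 0 < e / 2 by rewrite divr_gt0.
have [G1 g1 HG1] := H1 _ e2; have [G2 g2 HG2] := H2 _ e2.
exists (fun x => G1 x + G2 x); first exact: finite_rank_add.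
move=> x; rewrite opprD addrACA; apply: le_trans (complete_normD NV _ _) _.
by have := HG1 x; have := HG2 x; lra.
Qed.

Lemma almost_finite_rank_compl T K : bounded_map T ->
  almost_finite_rank K -> almost_finite_rank (T \o K).
Proof.
move=> bT [bK HK]; split; first exact: bounded_comp.
move=> e e0; have [C C0 HC] := bounded_ge0 bT; have TL := bT.1.
have [G gG HG] := HK _ (divr_gt0 e0 C0).
exists (T \o G); first exact: finite_rank_compl.
move=> x /=; rewrite -linB //; apply: le_trans (HC _) _.
by rewrite -ler_pdivlMl // mulrA [_^-1 * e]mulrC.
Qed.

Lemma almost_finite_rank_compr T K : bounded_map T ->
  almost_finite_rank K -> almost_finite_rank (K \o T).
Proof.
move=> bT [bK HK]; split; first exact: bounded_comp.
move=> e e0; have [C C0 HC] := bounded_ge0 bT; have TL := bT.1.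
have [G gG HG] := HK _ (divr_gt0 e0 C0).
exists (G \o T); first exact: finite_rank_compr.
move=> x /=; apply: le_trans (HG _) _.
by rewrite mulrAC ler_pdivrMr // -mulrA ler_pM2l // mulrC.
Qed.

Definition projects_onto Q D :=
  [/\ bounded_map Q, forall x, D (Q x) & forall x, D x -> Q x = x].

Lemma projects_onto_subspace Q D : projects_onto Q D -> subspace D.
Proof.
move=> [[QL _] DQ QD]; split; first by rewrite -(lin0 QL).
by move=> a x y /QD <- /QD <-; rewrite -QL.
Qed.

(** Split [K] into a finite rank operator and a remainder so small that its
    compression [S] to [D] is a contraction; then [1 + S] is bijective on [D].
    The fixed point lives in the whole complete space, and it lies in [D]
    because [S] takes its values there. *)
Lemma riesz_decomposition Q D K : projects_onto Q D -> almost_finite_rank K ->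
  (forall x, D x -> D (K x)) ->
  exists B G : V -> V, [/\ linear B, finite_rank G,
    forall x, D x -> B x = 0 -> x = 0, B @` D = D
    & forall x, D x -> x + K x = B x + G x].
Proof.
move=> pQ [[KL _] HK] DK; have sD := projects_onto_subspace pQ.
have [bQ DQ QD] := pQ; have [C C0 HC] := bounded_ge0 bQ; have QL := bQ.1.
have e0 : 0 < 1 / (2 * C) by rewrite divr_gt0 // mulr_gt0.
have [G gG HG] := HK _ e0; have GL := gG.1.
pose S x := Q (K x - G x).
have SL : linear S.
  move=> a x y; rewrite /S KL GL opprD addrACA -scalerBr.
  by rewrite QL.
have NS x : N (S x) <= N x / 2.
  apply: le_trans (HC _) _; rewrite -ler_pdivlMl //; apply: le_trans (HG x) _.
  suff -> : 1 / (2 * C) * N x = C^-1 * (N x / 2) by [].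
  by field; rewrite gt_eqF.
exists (fun x => x + S x), (Q \o G); split.
- by move=> a x y; rewrite SL scalerDr addrACA.
- exact: finite_rank_compl.
- move=> x _ /eqP; rewrite addr_eq0 => /eqP xS; apply: (complete_norm0_eq NV).
  have := NS x; rewrite -[S x]opprK -xS (complete_normN NV).
  by have := complete_norm_ge0 NV x; lra.
- apply/seteqP; split=> [_ [x Dx <-]|y Dy].
    by apply: subspaceD => //; exact: DQ.
  have [||||x [xE _ _]] := @contraction_fixpoint _ _ _ NV
      (fun x => y - S x) (fun=> True) => //.
    move=> x z _ _ /=; rewrite opprB addrC addrA subrK -linB //.
    by rewrite (le_trans (NS _)) // (complete_norm_sym NV).
  exists x; last by rewrite -{1}xE subrK.
  by rewrite -xE; apply: subspaceB => //; exact: DQ.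
- move=> x Dx; rewrite /= -addrA -(linD _ _ QL).
  by rewrite subrK QD //; exact: DK.
Qed.

(** The indices of [T] and [S] are opposite, since [S T] is a bijection plus an
    operator of finite rank and so has index 0. *)
Lemma fredholm_of_parametrix D E QD QE S T K K' :
  projects_onto QD D -> projects_onto QE E ->
  linear T -> linear S ->
  (forall x, D x -> E (T x)) -> (forall y, E y -> D (S y)) ->
  almost_finite_rank K -> (forall x, D x -> S (T x) = x + K x) ->
  almost_finite_rank K' -> (forall x, E x -> T (S x) = x + K' x) ->
  exists2 n, fredholm_index D E T n & fredholm_index E D S (- n).
Proof.
move=> pD pE TL SL DE ED aK ST aK' TS.
have sD := projects_onto_subspace pD; have sE := projects_onto_subspace pE.
have DK x : D x -> D (K x).
  move=> Dx; rewrite -[K x](addKr x) addrC -ST //.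
  by apply: subspaceB => //; exact/ED/DE.
have EK x : E x -> E (K' x).
  move=> Ex; rewrite -[K' x](addKr x) addrC -TS //.
  by apply: subspaceB => //; exact/DE/ED.
have [B [G [BL gG Bi BD BG]]] := riesz_decomposition pD aK DK.
have [B' [G' [BL' gG' Bi' BE BG']]] := riesz_decomposition pE aK' EK.
have STB x : D x -> S (T x) = B x + G x by move=> Dx; rewrite ST // BG.
have TSB x : E x -> T (S x) = B' x + G' x by move=> Ex; rewrite TS // BG'.
have [n Tn] :=
  fredholm_exists sD sE TL SL DE ED BL gG Bi STB BL' gG' Bi' BE TSB.
have [m Sm] :=
  fredholm_exists sE sD SL TL ED DE BL' gG' Bi' TSB BL gG Bi BD STB.
have c := fredholm_index_comp sD sE sD TL SL DE ED Tn Sm.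
have c0 : fredholm_index D D (S \o T) 0.
  exact: (fredholm_index_bij sD sD BL gG Bi BD).
have DD x : D x -> D ((S \o T) x) by move=> Dx /=; exact/ED/DE.
have := fredholm_index_uniq sD sD (linear_comp TL SL) DD c c0.
by move/eqP; rewrite addr_eq0 => /eqP nm; exists n; rewrite // nm opprK.
Qed.

(** The operator [S] inverts [T'] as well as [T] up to the ideal, so the index
    of both is the opposite of the index of [S]. *)
Lemma fredholm_index_perturb D E QD QE S T T' K K' L :
  projects_onto QD D -> projects_onto QE E ->
  bounded_map T -> linear T' -> bounded_map S ->
  (forall x, D x -> E (T x)) -> (forall x, D x -> E (T' x)) ->
  (forall y, E y -> D (S y)) ->
  almost_finite_rank K -> (forall x, D x -> S (T x) = x + K x) ->
  almost_finite_rank K' -> (forall x, E x -> T (S x) = x + K' x) ->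
  almost_finite_rank L -> (forall x, D x -> T' x = T x + L x) ->
  exists2 n, fredholm_index D E T n & fredholm_index D E T' n.
Proof.
move=> pD pE [TL _] TL' bS DE DE' ED aK ST aK' TS aL TT.
have SL := bS.1.
have [n Tn Sn] := fredholm_of_parametrix pD pE TL SL DE ED aK ST aK' TS.
have [||||m Tm Sm] := @fredholm_of_parametrix D E QD QE S T'
  (fun x => K x + (S \o L) x) (fun x => K' x + (L \o S) x) pD pE TL' SL DE' ED.
- by apply: almost_finite_rank_add => //; exact: almost_finite_rank_compl.
- by move=> x Dx; rewrite TT // linD // ST // addrA.
- by apply: almost_finite_rank_add => //; exact: almost_finite_rank_compr.
- by move=> x Ex; rewrite TT ?TS ?addrA //; exact: ED.
have sD := projects_onto_subspace pD; have sE := projects_onto_subspace pE.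
exists n => //; suff -> : n = m by [].
by apply: oppr_inj; exact: (fredholm_index_uniq sE sD SL ED Sn Sm).
Qed.

End Operators.

(** * Compact operators on a Hilbert space *)

Section Hilbert.
Variables (R : realType) (H : hilbertType R).
Implicit Types (x y z : H) (a : R[i]).

(** The norm of [H] has its values in the complex numbers. *)
Definition hnorm x : R := complex.Re `|x|.

Lemma hnormE x : `|x| = (hnorm x)%:C.
Proof. by rewrite RRe_real // ger0_real. Qed.

Lemma hnorm_le x y (c : R) : (`|x| <= c%:C * `|y|) = (hnorm x <= c * hnorm y).
Proof. by rewrite !hnormE -rmorphM lecR. Qed.

Lemma hnorm_complete : is_complete_norm hnorm.
Proof.
split.
- by move=> x y; have := ler_normB x y; rewrite !hnormE -rmorphD lecR.
- by rewrite /hnorm normr0.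
- by move=> x x0; apply/eqP; rewrite -normr_eq0 hnormE x0.
- move=> u uc.
  have : cvg (u @ \oo).
    apply: cauchy_cvg; apply/cauchyP => e e0.
    have eE : e = (complex.Re e)%:C by rewrite RRe_real // gtr0_real.
    have e0' : 0 < complex.Re e by rewrite -ltcR -eE.
    have [M HM] := uc _ e0'; exists (u M).
    exists M => // n /= Mn; rewrite -ball_normE /= hnormE eE ltcR.
    exact: HM.
  move=> /cvgrPdist_lt ul; exists (lim (u @ \oo)) => e e0.
  have [|M _ HM] := ul e%:C; first by rewrite ltcR.
  exists M => n Mn; rewrite -ltcR -hnormE distrC.
  exact: HM.
Qed.

Lemma bounded_operator_map (T : H -> H) : bounded_operator T ->
  bounded_map hnorm T.
Proof.
move=> [TL Tc]; split=> //.
pose f : {linear H -> H} := HB.pack T (GRing.isLinear.Build _ _ _ _ T TL).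
have /linear_boundedP bf : bounded_near f (nbhs (0 : H)).
  by apply: continuous_linear_bounded; exact: Tc.
have [r r0 Hr] := pinfty_ex_gt0 bf; exists (complex.Re r) => x.
by rewrite -hnorm_le RRe_real ?gtr0_real.
Qed.

Lemma innerDl x y z : inner (x + y) z = inner x z + inner y z.
Proof. exact: linearDl. Qed.
Lemma innerBl x y z : inner (x - y) z = inner x z - inner y z.
Proof. exact: linearBl. Qed.
Lemma innerDr x y z : inner z (x + y) = inner z x + inner z y.
Proof. exact: linearDr. Qed.
Lemma innerZl a x z : inner (a *: x) z = a * inner x z.
Proof. exact: linearZl_LR. Qed.
Lemma innerZr a x z : inner z (a *: x) = Num.conj a * inner z x.
Proof. exact: linearZr_LR. Qed.
Lemma innerC x y : inner x y = Num.conj (inner y x).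
Proof. by rewrite hermC /= expr0 mul1r. Qed.
Lemma inner_eq0 x : inner x x = 0 -> x = 0.
Proof.
by rewrite inner_norm => /eqP; rewrite expf_eq0 /= normr_eq0 => /eqP.
Qed.

Lemma inner0_sym x y : inner x y = 0 -> inner y x = 0.
Proof. by move=> xy; rewrite innerC xy rmorph0. Qed.

(** This is equivalent to being a self-adjoint idempotent. *)
Definition orthoprojection (Q : H -> H) :=
  linear Q /\ forall x z, inner (x - Q x) (Q z) = 0.

Lemma orthoprojection_contr Q x : orthoprojection Q -> `|x - Q x| <= `|x|.
Proof.
move=> [QL Qo]; rewrite -(@ler_pXn2r _ 2) ?nnegrE // -!inner_norm.
have : inner x x = inner (x - Q x) (x - Q x) + inner (Q x) (Q x).
  have := Qo x x; rewrite -{4 5}[x](subrK (Q x)); move: (x - Q x) => u uQ.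
  by rewrite innerDl !innerDr uQ (inner0_sym uQ) addr0 add0r.
by move=> ->; rewrite lerDl inner_norm exprn_ge0.
Qed.

(** One step of the Gram-Schmidt process for each element of the list: if [y] is
    the part of [y0] orthogonal to the range of [Q], add to [Q] the projection
    onto the line of [y]. *)
Lemma orthoprojection_span (s : seq H) : exists Q : H -> H,
  [/\ orthoprojection Q, finite_rank Q & forall y, y \in s -> Q y = y].
Proof.
elim: s => [|y0 s [Q [[QL Qo] [_ [n [f [fL f0]]]] Qs]]].
  exists (fun=> 0); split=> //; last exact: finite_rank0.
  by split=> [a x y|x z]; [rewrite scaler0 addr0 | rewrite linear0r].
pose y := y0 - Q y0.
have yQ z : inner y (Q z) = 0 by exact: Qo.
have Qy z : inner (Q z) y = 0 by exact: inner0_sym.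
have [y_0|y_n0] := eqVneq y 0.
  exists Q; split=> // [|z]; first by split=> //; exists n, f.
  rewrite in_cons => /orP[/eqP ->|/Qs//].
  by apply/esym/eqP; rewrite -subr_eq0; apply/eqP.
have yy : inner y y != 0 by apply: contra_neq y_n0 => /inner_eq0.
pose c x := inner x y / inner y y.
have cL a u v : c (a *: u + v) = a * c u + c v.
  by rewrite /c innerDl innerZl mulrDl mulrA.
pose Q' x := Q x + c x *: y.
have Q'L : linear Q'.
  move=> a u v; rewrite /Q' QL cL scalerDl -scalerA addrACA.
  by rewrite [a *: (Q u + _)]scalerDr.
exists Q'; split.
- split=> // x z; rewrite /Q' opprD addrA innerBl innerDr Qo add0r innerDr.
  rewrite !innerZl yQ mulr0 add0r !innerZr innerBl Qy subr0 mulrCA.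
  by rewrite /c divfK // subrr.
- split=> //; exists (n + 1)%N, (fun x => row_mx (f x) (c x)%:M); split.
    move=> a u v; rewrite fL cL scale_row_mx add_row_mx scale_scalar_mx.
    by rewrite raddfD.
  move=> x; rewrite -[0](@row_mx0 _ 1 n 1) => /eq_row_mx[/f0 fx].
  move/matrixP/(_ 0 0); rewrite !mxE mulr1n => cx.
  by rewrite /Q' fx cx scale0r addr0.
- move=> z; rewrite in_cons => /orP[/eqP ->|sz].
    have -> : Q' y0 = Q y0 + y.
      have iy : inner y0 y = inner y y.
        by rewrite -[RHS]addr0 -(Qy y0) -innerDl subrK.
      by rewrite /Q' /c iy divff // scale1r.
    by rewrite addrC subrK.
  by rewrite /Q' Qs // /c -[z]Qs // Qy mul0r scale0r addr0.
Qed.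

(** Cover the image of the unit ball by balls of radius [e], and project
    orthogonally onto the span of their centres: the projection fixes the
    centres, and its complement does not increase norms, so it moves no point of
    the image by more than [e]. *)
Lemma compact_almost_finite_rank (K : H -> H) : bounded_operator K ->
  compact_operator K -> almost_finite_rank hnorm K.
Proof.
move=> bK cK; split; first exact: bounded_operator_map.
move=> e e0; have KL := bK.1.
have [s Hs] : exists s : seq H, forall x, `|x| <= 1 ->
    exists2 y, y \in s & `|K x - y| <= e%:C.
  move: cK; rewrite /compact_operator precompactE compact_cover => cK.
  have eC : (0 : R[i]) < e%:C by rewrite ltcR.
  have [||D _ HD] := cK H setT (fun y => (ball y e%:C)^°).
  - by move=> y _; exact: open_interior.
  - by move=> x _; exists x => //; exact: nbhsx_ballx.
  exists (finmap.enum_fset D) => x x1; have [|y yD yx] := HD (K x).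
    by apply: subset_closure; exists x.
  exists y; first by [].
  move/interior_subset: yx; rewrite -ball_normE /= distrC; exact: ltW.
have [Q [oQ fQ Qs]] := orthoprojection_span s; have QL := oQ.1.
exists (Q \o K); first exact: finite_rank_compr.
move=> x; rewrite -hnorm_le /=.
have small z : `|z| <= 1 -> `|K z - Q (K z)| <= e%:C.
  move=> /Hs[y sy]; apply: le_trans.
  have -> : K z - Q (K z) = (K z - y) - Q (K z - y).
    by rewrite (linB _ _ QL) (Qs _ sy) opprB addrA subrK.
  exact: orthoprojection_contr.
have [->|x0] := eqVneq x 0.
  by rewrite (lin0 KL) (lin0 QL) subrr normr0 mulr0.
have nx : `|x| != 0 by rewrite normr_eq0.
have := small (`|x|^-1 *: x); rewrite normfZV // => /(_ (lexx _)).
rewrite (linZ _ _ KL) (linZ _ _ QL) -scalerBr normrZ ger0_norm ?invr_ge0 //.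
by rewrite ler_pdivrMl ?normr_gt0 // mulrC.
Qed.

End Hilbert.

(** * The index of an idempotent *)

Section MatrixOperators.
Variables (R : realType) (H : hilbertType R) (k : nat).
Notation V := {ffun 'I_k -> H}.
Implicit Types (T G : 'I_k -> 'I_k -> H -> H) (v : V).

Definition vnorm v : R := \sum_i hnorm (v i).

Lemma vnorm_complete : is_complete_norm vnorm.
Proof.
apply: (@coordinatewise_complete R H V 'I_k (@hnorm R H) (fun v i => v i)
  (fun g => [ffun i => g i]) (@hnorm_complete R H)).
- by move=> g i; rewrite ffunE.
- by move=> x y i; rewrite !ffunE.
- by move=> x x0; apply/ffunP=> i; rewrite x0 ffunE.
Qed.

Definition matrix_op T v : V := [ffun i => \sum_j T i j (v j)].

Lemma matrix_op_linear T : (forall i j, linear (T i j)) -> linear (matrix_op T).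
Proof.
move=> TL a x y; apply/ffunP=> i; rewrite !ffunE scaler_sumr -big_split /=.
by apply: eq_bigr => j _; rewrite !ffunE TL.
Qed.

Lemma matrix_op_le T (C : R) v :
  (forall i j x, hnorm (T i j x) <= C * hnorm x) ->
  vnorm (matrix_op T v) <= k%:R * C * vnorm v.
Proof.
move=> TC; have hN := @hnorm_complete R H.
have -> : k%:R * C * vnorm v = \sum_(i < k) C * vnorm v.
  by rewrite sumr_const card_ord -mulrA mulr_natl.
apply: ler_sum => i _; rewrite ffunE mulr_sumr.
apply: (@le_trans _ _ (\sum_j hnorm (T i j (v j)))); last exact: ler_sum.
elim/big_rec2: _ => [|j a b _ ab]; first by rewrite (complete_norm0 hN).
by apply: le_trans (complete_normD hN _ _) _; rewrite lerD2l.
Qed.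

Lemma matrix_op_bounded T : (forall i j, bounded_map (@hnorm R H) (T i j)) ->
  bounded_map vnorm (matrix_op T).
Proof.
move=> bT; split; first by apply: matrix_op_linear => i j; case: (bT i j).
have /choice[C HC] : forall ij : 'I_k * 'I_k, exists C : R,
    0 < C /\ forall x, hnorm (T ij.1 ij.2 x) <= C * hnorm x.
  move=> [i j]; have [C] := bounded_ge0 (@hnorm_complete R H) (bT i j).
  by exists C.
exists (k%:R * \sum_ij C ij) => v; apply: matrix_op_le => i j x.
apply: le_trans ((HC (i, j)).2 x) _.
rewrite ler_wpM2r ?(complete_norm_ge0 (@hnorm_complete R H)) //.
rewrite (bigD1 (i, j)) //=.
by rewrite lerDl sumr_ge0 // => ij _; exact/ltW/(HC ij).1.
Qed.

Lemma finite_rank_sum (I : finType) (U W : lmodType R[i]) (G : I -> U -> W) :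
  (forall i, finite_rank (G i)) -> finite_rank (fun x => \sum_i G i x).
Proof.
move=> fG; elim: (index_enum I) => [|i r IH].
  rewrite (_ : (fun x => _) = fun=> 0); first exact: finite_rank0.
  by apply/funext => x; rewrite big_nil.
rewrite (_ : (fun x => _) = fun x => G i x + \sum_(j <- r) G j x).
  exact: finite_rank_add.
by apply/funext => x; rewrite big_cons.
Qed.

Lemma matrix_op_finite_rank T : (forall i j, finite_rank (T i j)) ->
  finite_rank (matrix_op T).
Proof.
move=> fT.
pose inc (i : 'I_k) (x : H) : V := [ffun l => if l == i then x else 0].
have incL i : linear (inc i).
  move=> a x y; apply/ffunP=> l; rewrite !ffunE.
  by case: eqP => // _; rewrite scaler0 addr0.
have prL (j : 'I_k) : linear (fun v : V => v j) by move=> a x y; rewrite !ffunE.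
rewrite (_ : matrix_op T = fun v => \sum_i \sum_j inc i (T i j (v j))).
  apply: finite_rank_sum => i; apply: finite_rank_sum => j.
  exact: (finite_rank_compl (incL i) (finite_rank_compr (prL j) (fT i j))).
apply/funext => v; apply/ffunP=> l; rewrite ffunE sum_ffunE [RHS](bigD1 l) //=.
rewrite [X in _ = _ + X]big1 => [|i il]; last first.
  rewrite sum_ffunE big1 // => j _; rewrite ffunE eq_sym.
  by rewrite (negbTE il).
by rewrite addr0 sum_ffunE; apply: eq_bigr => j _; rewrite ffunE eqxx.
Qed.

Lemma matrix_op_almost_finite_rank T :
  (forall i j, almost_finite_rank (@hnorm R H) (T i j)) ->
  almost_finite_rank vnorm (matrix_op T).
Proof.
move=> aT; split; first by apply: matrix_op_bounded => i j; case: (aT i j).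
move=> e e0; pose d := e / k.+1%:R; have d0 : 0 < d by rewrite divr_gt0.
have /choice[G HG] : forall ij : 'I_k * 'I_k, exists G : H -> H,
    finite_rank G /\ forall x, hnorm (T ij.1 ij.2 x - G x) <= d * hnorm x.
  by move=> [i j]; have [G] := (aT i j).2 d d0; exists G.
exists (matrix_op (fun i j => G (i, j))).
  by apply: matrix_op_finite_rank => i j; case: (HG (i, j)).
move=> v; have -> : matrix_op T v - matrix_op (fun i j => G (i, j)) v =
    matrix_op (fun i j x => T i j x - G (i, j) x) v.
  apply/ffunP=> i; rewrite !ffunE -sumrB.
  by apply: eq_bigr => j _.
apply: le_trans (@matrix_op_le _ d _ _) _ => [i j x|].
  by case: (HG (i, j)).
apply: ler_wpM2r; first exact: (complete_norm_ge0 vnorm_complete).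
rewrite /d mulrCA; apply: ler_piMr; first exact: ltW.
by rewrite ler_pdivrMr // mul1r ler_nat.
Qed.

End MatrixOperators.

Section CornerIndex.
Variables (R : realType) (A : cstarAlgType R) (m : even_fredholm A) (k : nat).
Notation H := (fm_space m).
Notation V := {ffun 'I_k -> H}.
Notation corner_operator := (corner_operator (m := m)).
Implicit Types (a b p q x y : 'M[A]_k) (v w : V).

Let fm := fm_axioms m.
Let rep := fm_rep fm.
Notation N := (@vnorm R H k).
Let NV : is_complete_norm N := @vnorm_complete R H k.

Definition mxrep a : V -> V := rep_mx (fm_pi m) a.
Definition ampF v : V := [ffun i => fm_F m (v i)].
Definition ampG v : V := [ffun i => fm_gamma m (v i)].

Lemma pi_linear (a : A) : linear (fm_pi m a).
Proof. exact: (rep_bounded rep a).1. Qed.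

Lemma pi0 u : fm_pi m 0 u = 0.
Proof.
have := rep_linear rep (-1) 0 0 u.
by rewrite scaler0 addr0 scaleN1r addNr.
Qed.

Lemma piD (a b : A) u : fm_pi m (a + b) u = fm_pi m a u + fm_pi m b u.
Proof. by have := rep_linear rep 1 a b u; rewrite !scale1r. Qed.

Lemma pi_sum (I : finType) (F : I -> A) u :
  fm_pi m (\sum_i F i) u = \sum_i fm_pi m (F i) u.
Proof.
elim: (index_enum I) => [|i r IH]; first by rewrite !big_nil pi0.
by rewrite !big_cons piD IH.
Qed.

Lemma mxrep_linear a : linear (mxrep a).
Proof.
apply: (matrix_op_linear (T := fun i j => fm_pi m (a i j))) => i j.
exact: pi_linear.
Qed.

Lemma mxrepM a b v : mxrep (a * b) v = mxrep a (mxrep b v).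
Proof.
apply/ffunP=> i; rewrite !ffunE.
under eq_bigr do rewrite mxE pi_sum.
rewrite exchange_big /=; apply: eq_bigr => l _; rewrite ffunE.
rewrite (lin_sum _ (pi_linear _)); apply: eq_bigr => j _.
exact: rep_mul rep _ _ _.
Qed.

Lemma mxrepD a b v : mxrep (a + b) v = mxrep a v + mxrep b v.
Proof.
apply/ffunP=> i; rewrite !ffunE -big_split; apply: eq_bigr => j _ /=.
by rewrite mxE piD.
Qed.

Lemma mxrep0 v : mxrep 0 v = 0.
Proof. by apply/ffunP=> i; rewrite !ffunE big1 // => j _; rewrite mxE pi0. Qed.

Lemma mxrep_bounded a : bounded_map N (mxrep a).
Proof.
apply: (matrix_op_bounded (T := fun i j => fm_pi m (a i j))) => i j.
exact/bounded_operator_map/(rep_bounded rep).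
Qed.

Lemma pointwise_bounded (T : H -> H) : bounded_map (@hnorm R H) T ->
  bounded_map N (fun v => [ffun i => T (v i)] : V).
Proof.
move=> [TL [C HC]]; split.
  by move=> a x y; apply/ffunP=> i; rewrite !ffunE TL.
exists C => v; rewrite /vnorm mulr_sumr ler_sum // => i _.
by rewrite ffunE.
Qed.

Lemma ampF_bounded : bounded_map N ampF.
Proof. exact/pointwise_bounded/bounded_operator_map/(fm_F_bounded fm). Qed.

Lemma ampG_bounded : bounded_map N ampG.
Proof. exact/pointwise_bounded/bounded_operator_map/(fm_gamma_bounded fm). Qed.

Lemma scale_bounded (c : R[i]) : bounded_map N (fun v => c *: v).
Proof.
rewrite (_ : (fun v => _) = fun v => [ffun i => c *: v i]).
  apply: pointwise_bounded; split.
    by move=> a x y; rewrite scalerDr !scalerA mulrC.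
  exists (complex.Re `|c|) => x.
  by rewrite -hnorm_le RRe_real ?normr_real // normrZ.
by apply/funext => v; apply/ffunP=> i; rewrite !ffunE.
Qed.

Lemma ampF_sqr v : ampF (ampF v) = v.
Proof. by apply/ffunP=> i; rewrite !ffunE (fm_F_sqr fm). Qed.

Lemma ampG_sqr v : ampG (ampG v) = v.
Proof. by apply/ffunP=> i; rewrite !ffunE (fm_gamma_sqr fm). Qed.

Lemma ampG_mxrep a v : ampG (mxrep a v) = mxrep a (ampG v).
Proof.
apply/ffunP=> i; rewrite !ffunE (lin_sum _ (fm_gamma_bounded fm).1).
by apply: eq_bigr => j _; rewrite ffunE (fm_rep_even fm).
Qed.

Lemma ampG_ampF v : ampG (ampF v) = - ampF (ampG v).
Proof. by apply/ffunP=> i; rewrite !ffunE (fm_F_odd fm) opprK. Qed.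

Definition commF a v := ampF (mxrep a v) - mxrep a (ampF v).

Lemma commF_compact a : almost_finite_rank N (commF a).
Proof.
rewrite (_ : commF a = matrix_op (fun i j u =>
    fm_F m (fm_pi m (a i j) u) - fm_pi m (a i j) (fm_F m u))).
  apply: matrix_op_almost_finite_rank => i j.
  apply: compact_almost_finite_rank (fm_compact fm _).
  have [FL Fc] := fm_F_bounded fm; have [pL pc] := rep_bounded rep (a i j).
  split; first by move=> c u v; rewrite pL !FL pL scalerBr opprD addrACA.
  move=> u; apply: cvgB; first exact: (continuous_comp (pc _) (Fc _)).
  exact: (continuous_comp (Fc _) (pc _)).
apply/funext => v; apply/ffunP=> i; rewrite !ffunE.
rewrite (lin_sum _ (fm_F_bounded fm).1) -sumrB.
by apply: eq_bigr => j _; rewrite ffunE.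
Qed.

(** For an idempotent [p] this is the corner space; as a set of fixed vectors
    it is visibly closed under the operators that commute with [p]. *)
Definition corner p (s : R[i]) : set V :=
  [set v | mxrep p v = v /\ ampG v = s *: v].

Lemma corner_spaceE p s : p * p = p -> corner_space (m := m) p s = corner p s.
Proof.
move=> pp; apply/seteqP; split=> [_ [u us <-]|v [pv Gv]].
  rewrite -/(mxrep p u); split; first by rewrite -mxrepM pp.
  rewrite ampG_mxrep (_ : ampG u = s *: u) ?(linZ _ _ (mxrep_linear p)) //.
  by apply/ffunP=> i; rewrite !ffunE us.
exists v => // i.
by move/ffunP/(_ i): Gv; rewrite !ffunE.
Qed.

Definition eigenprojection (s : R[i]) v : V := 2^-1 *: (v + s *: ampG v).

Lemma corner_projects p s : p * p = p -> s * s = 1 ->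
  projects_onto N (mxrep p \o eigenprojection s) (corner p s).
Proof.
move=> pp ss; have GL := ampG_bounded.1; have PL := mxrep_linear p; split.
- apply: (bounded_comp NV (mxrep_bounded p)).
  have bs := bounded_comp NV (scale_bounded s) ampG_bounded.
  have bs1 := bounded_add NV (bounded_id N) bs.
  exact: (bounded_comp NV (scale_bounded 2^-1) bs1).
- move=> v; split; first by rewrite /= -mxrepM pp.
  rewrite /= ampG_mxrep -(linZ _ _ PL); congr (mxrep p _).
  rewrite /eigenprojection (linZ _ _ GL) (linD _ _ GL) (linZ _ _ GL) ampG_sqr.
  rewrite [RHS]scalerA [s * _]mulrC -[RHS]scalerA; congr (_ *: _).
  by rewrite [RHS]scalerDr scalerA ss scale1r addrC.
- move=> v [pv Gv]; rewrite /= /eigenprojection Gv scalerA ss scale1r.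
  have -> : v + v = (2 : R[i]) *: v by rewrite scaler_nat mulr2n.
  by rewrite scalerA mulVf ?pnatr_eq0 // scale1r.
Qed.

Lemma sqr1 : (1 : R[i]) * 1 = 1. Proof. by rewrite mulr1. Qed.
Lemma sqrN1 : (-1 : R[i]) * -1 = 1. Proof. by rewrite mulrNN mulr1. Qed.

Lemma corner_subspace p s : p * p = p -> s * s = 1 -> subspace (corner p s).
Proof.
by move=> pp ss; exact: projects_onto_subspace (corner_projects pp ss).
Qed.

Lemma mxrep_corner p a s v : p * a = a -> ampG v = s *: v ->
  corner p s (mxrep a v).
Proof.
move=> pa Gv; split; first by rewrite -mxrepM pa.
by rewrite ampG_mxrep Gv (linZ _ _ (mxrep_linear a)).
Qed.

Lemma corner_operatorE p v :
  corner_operator p v = mxrep p (ampF (mxrep p v)).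
Proof. by []. Qed.

Lemma corner_operator_bounded p : bounded_map N (corner_operator p).
Proof.
apply: (bounded_comp NV (mxrep_bounded p)).
exact: (bounded_comp NV ampF_bounded (mxrep_bounded p)).
Qed.

Lemma corner_operator_corner p s v : p * p = p -> corner p s v ->
  corner p (- s) (corner_operator p v).
Proof.
move=> pp [pv Gv]; rewrite corner_operatorE pv; apply: mxrep_corner => //.
by rewrite ampG_ampF Gv (linZ _ _ ampF_bounded.1) scaleNr.
Qed.

Lemma corner_operator_cornerN p v : p * p = p -> corner p (-1) v ->
  corner p 1 (corner_operator p v).
Proof. by move=> pp /(corner_operator_corner pp); rewrite opprK. Qed.

Lemma almost_finite_rank_opp K : almost_finite_rank N K ->
  almost_finite_rank N (fun v => - K v).
Proof.
apply: (@almost_finite_rank_compl R V N NV (fun v => - v)).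
split; first by move=> a x y; rewrite opprD scalerN.
by exists 1 => v; rewrite mul1r (complete_normN NV).
Qed.

Lemma mxrep_commF_compact a b :
  almost_finite_rank N (fun v => mxrep a (commF b v)).
Proof.
exact: (almost_finite_rank_compl NV (mxrep_bounded a) (commF_compact b)).
Qed.

Definition defect p v := - mxrep p (ampF (commF p v)).

Lemma defect_compact p : almost_finite_rank N (defect p).
Proof.
apply: almost_finite_rank_opp.
apply: (almost_finite_rank_compl NV (mxrep_bounded p)).
exact: (almost_finite_rank_compl NV ampF_bounded (commF_compact p)).
Qed.

(** [F] squares to the identity and commutes with [p] up to compact operators,
    so the corner operator, as a map between the two corner spaces in either
    direction, is its own inverse up to compact operators. *)
Lemma corner_operator_sqr p s v : p * p = p -> corner p s v ->
  corner_operator p (corner_operator p v) = v + defect p v.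
Proof.
move=> pp [pv _]; have FL := ampF_bounded.1; have PL := mxrep_linear p.
rewrite /defect /commF pv (linB _ _ FL) ampF_sqr (linB _ _ PL) pv.
by rewrite opprB addrC subrK !corner_operatorE -mxrepM pp pv.
Qed.

Definition has_index p n :=
  fredholm_index (corner p 1) (corner p (-1)) (corner_operator p) n.

Lemma has_index_exists p : p * p = p -> exists n, has_index p n.
Proof.
move=> pp; have [] := @fredholm_of_parametrix R V N NV _ _ _ _
  (corner_operator p) (corner_operator p) (defect p) (defect p)
  (corner_projects pp sqr1) (corner_projects pp sqrN1).
- exact: (corner_operator_bounded p).1.
- exact: (corner_operator_bounded p).1.
- by move=> v; exact: corner_operator_corner.
- by move=> v; exact: corner_operator_cornerN.
- exact: defect_compact.
- by move=> v; exact: corner_operator_sqr.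
- exact: defect_compact.
- by move=> v; exact: corner_operator_sqr.
by move=> n pn _; exists n.
Qed.

Lemma has_index_uniq p i j : p * p = p ->
  has_index p i -> has_index p j -> i = j.
Proof.
move=> pp; apply: fredholm_index_uniq.
- exact: corner_subspace sqr1.
- exact: corner_subspace sqrN1.
- exact: (corner_operator_bounded p).1.
- by move=> v; exact: corner_operator_corner.
Qed.

(** The index of [p] may be computed from any compact perturbation of the
    corner operator. *)
Lemma has_index_perturb p T L n : p * p = p -> linear T ->
  (forall v, corner p 1 v -> corner p (-1) (T v)) -> almost_finite_rank N L ->
  (forall v, corner p 1 v -> T v = corner_operator p v + L v) ->
  fredholm_index (corner p 1) (corner p (-1)) T n -> has_index p n.
Proof.
move=> pp TL Tc aL TE Tn.
have [|||||||||l pl Tl] := @fredholm_index_perturb R V N NV _ _ _ _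
  (corner_operator p) (corner_operator p) T (defect p) (defect p) L
  (corner_projects pp sqr1) (corner_projects pp sqrN1)
  (corner_operator_bounded p) TL (corner_operator_bounded p).
- by move=> v; exact: corner_operator_corner.
- exact: Tc.
- by move=> v; exact: corner_operator_cornerN.
- exact: defect_compact.
- by move=> v; exact: corner_operator_sqr.
- exact: defect_compact.
- by move=> v; exact: corner_operator_sqr.
- exact: aL.
- exact: TE.
rewrite (_ : n = l) //; apply: (fredholm_index_uniq _ _ TL Tc Tn Tl).
- exact: corner_subspace sqr1.
- exact: corner_subspace sqrN1.
Qed.

Lemma mxrep_corner_iso p q x y s : p * p = p -> q * q = q -> s * s = 1 ->
  y * x = p -> x * y = q -> q * x = x -> p * y = y ->
  fredholm_index (corner p s) (corner q s) (mxrep x) 0.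
Proof.
move=> pp qq ss yx xy qx py; apply: fredholm_index_iso.
- exact: corner_subspace.
- exact: corner_subspace.
- exact: mxrep_linear.
- move=> v [pv _] xv; rewrite -pv -yx mxrepM xv.
  exact: lin0 (mxrep_linear y).
- apply/seteqP; split=> [_ [v [_ Gv] <-]|w [qw Gw]]; first exact: mxrep_corner.
  exists (mxrep y w); first exact: mxrep_corner.
  by rewrite -mxrepM xy.
Qed.

(** If [y x = p] and [x y = q], then [y] and [x] identify the corner spaces of
    [p] and [q], and carry the corner operator of [q] to [y F x].  The latter
    is a compact perturbation of [y x F = p F]. *)
Lemma has_index_equiv p q n : p * p = p -> q * q = q -> alg_equiv p q ->
  has_index q n -> has_index p n.
Proof.
move=> pp qq [x [y [yx xy [qx xp] [py yq]]]] qn.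
pose T := mxrep y \o (corner_operator q \o mxrep x).
have [xL yL] := (mxrep_linear x, mxrep_linear y).
have qL := (corner_operator_bounded q).1.
have TL : linear T by do 2![apply: linear_comp => //].
have xc v : corner p 1 v -> corner q 1 (mxrep x v).
  by case=> _; exact: mxrep_corner.
have yc v : corner q (-1) v -> corner p (-1) (mxrep y v).
  by case=> _; exact: mxrep_corner.
have qc v : corner q 1 v -> corner q (-1) (corner_operator q v).
  exact: corner_operator_corner.
apply: (has_index_perturb (T := T) (L := fun v => mxrep y (commF x v))) => //.
- by move=> v pv; exact/yc/qc/xc.
- exact: mxrep_commF_compact.
- move=> v [pv _]; rewrite /T /= !corner_operatorE -mxrepM yq -mxrepM qx.
  rewrite /commF (linB _ _ yL) -[mxrep y (mxrep x _)]mxrepM yx pv.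
  by rewrite addrC subrK.
- have ix := mxrep_corner_iso pp qq sqr1 yx xy qx py.
  have iy := mxrep_corner_iso qq pp sqrN1 xy yx py qx.
  have sub r s : r * r = r -> s * s = 1 -> subspace (corner r s).
    exact: corner_subspace.
  have ixq := fredholm_index_comp (sub _ _ pp sqr1) (sub _ _ qq sqr1)
    (sub _ _ qq sqrN1) xL qL xc qc ix qn.
  have := fredholm_index_comp (sub _ _ pp sqr1) (sub _ _ qq sqrN1)
    (sub _ _ pp sqrN1) (linear_comp xL qL) yL (fun v pv => qc _ (xc _ pv)) yc
    ixq iy.
  by rewrite add0r addr0.
Qed.

(** The cross terms [q1 F q2] and [q2 F q1] are compact, because [q1 q2 = 0 =
    q2 q1].  Up to a compact operator the corner operator of [q1 + q2] is thus
    the direct sum of those of [q1] and [q2]. *)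
Lemma has_index_sum q1 q2 n1 n2 : q1 * q1 = q1 -> q2 * q2 = q2 ->
  q1 * q2 = 0 -> q2 * q1 = 0 -> has_index q1 n1 -> has_index q2 n2 ->
  has_index (q1 + q2) (n1 + n2).
Proof.
move=> q11 q22 q12 q21 i1 i2; set q := q1 + q2.
have qq : q * q = q.
  by rewrite /q mulrDl !mulrDr q11 q12 q21 q22 addr0 add0r.
have [P1L P2L] := (mxrep_linear q1, mxrep_linear q2).
have T1L := (corner_operator_bounded q1).1.
have T2L := (corner_operator_bounded q2).1.
have split_q s v : corner q s v ->
    corner q1 s (mxrep q1 v) /\ corner q2 s (mxrep q2 v).
  by case=> _ Gv; split; exact: mxrep_corner.
have in1 s v : corner q1 s v -> mxrep q1 v = v /\ mxrep q2 v = 0.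
  by case=> pv _; split=> //; rewrite -pv -mxrepM q21 mxrep0.
have in2 s v : corner q2 s v -> mxrep q1 v = 0 /\ mxrep q2 v = v.
  by case=> pv _; split=> //; rewrite -pv -mxrepM q12 mxrep0.
have sub1 s : corner q1 s `<=` corner q s.
  move=> v cv; have [v1 v2] := in1 s v cv; split; last by case: cv.
  by rewrite mxrepD v1 v2 addr0.
have sub2 s : corner q2 s `<=` corner q s.
  move=> v cv; have [v1 v2] := in2 s v cv; split; last by case: cv.
  by rewrite mxrepD v1 v2 add0r.
have qE s v : corner q s v -> mxrep q1 v + mxrep q2 v = v.
  by case; rewrite mxrepD.
pose T v := corner_operator q1 v + corner_operator q2 v.
have TL : linear T by move=> a v w; rewrite /T T1L T2L scalerDr addrACA.
pose L v := - (mxrep q1 (commF q2 v) + mxrep q2 (commF q1 v)).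
have c1 v : corner q1 1 v -> corner q1 (-1) (corner_operator q1 v).
  exact: corner_operator_corner.
have c2 v : corner q2 1 v -> corner q2 (-1) (corner_operator q2 v).
  exact: corner_operator_corner.
have TP v :
    T v = corner_operator q1 (mxrep q1 v) + corner_operator q2 (mxrep q2 v).
  by rewrite /T !corner_operatorE -!mxrepM q11 q22.
apply: (has_index_perturb (T := T) (L := L)) => //.
- move=> v /split_q[v1 v2]; rewrite TP.
  apply: subspaceD; first exact: corner_subspace sqrN1.
    exact/sub1/c1.
  exact/sub2/c2.
- apply: almost_finite_rank_opp; apply: (almost_finite_rank_add NV).
    exact: mxrep_commF_compact.
  exact: mxrep_commF_compact.
- move=> v cv; have qv := qE _ _ cv.
  rewrite /T /L /commF (linB _ _ P1L) (linB _ _ P2L) -!mxrepM q12 q21.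
  rewrite !mxrep0 !subr0 !corner_operatorE cv.1 mxrepD.
  rewrite -{3 4}qv !(linD _ _ ampF_bounded.1) (linD _ _ P1L) (linD _ _ P2L).
  rewrite [mxrep q2 _ + mxrep q2 _]addrC addrACA.
  by rewrite [mxrep q1 (ampF (mxrep q2 v)) + _]addrC addrK.
- apply: (fredholm_index_sum (P1 := mxrep q1) (P2 := mxrep q2)
    (T1 := corner_operator q1) (T2 := corner_operator q2)
    _ _ _ _ _ _ c1 c2 (@split_q 1) (@split_q (-1))
    _ _ _ _ _ _ _ _ _ i1 i2) => //.
  + exact: corner_subspace sqr1.
  + by move=> v [] /in1.
  + by move=> v [] /in2.
  + by move=> v [] /qE.
  + exact: corner_subspace sqrN1.
Qed.

(** If every idempotent is, up to equivalence, a sum of two equivalent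
    orthogonal ones, then the index of every idempotent is twice the index of
    another one, and descent on the absolute value leaves only 0. *)
Lemma has_index_halving :
  (forall p, p * p = p -> exists q1 q2 : 'M[A]_k,
    [/\ q1 * q1 = q1, q2 * q2 = q2, q1 * q2 = 0 /\ q2 * q1 = 0,
        alg_equiv p (q1 + q2) & alg_equiv q2 q1]) ->
  forall p, p * p = p -> has_index p 0.
Proof.
move=> half p pp; have [n pn] := has_index_exists pp.
suff H N0 : forall p n, (`|n| <= N0)%N -> p * p = p -> has_index p n -> n = 0.
  by rewrite -(H _ _ _ (leqnn _) pp pn).
elim: N0 => [|N0 IH] {p n pp pn} p n; first by rewrite leqn0 absz_eq0 => /eqP.
move=> nN pp pn; have [q1 [q2 [q11 q22 [q12 q21] pq q12e]]] := half p pp.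
have [j ij] := has_index_exists q11.
have qq : (q1 + q2) * (q1 + q2) = q1 + q2.
  by rewrite mulrDl !mulrDr q11 q12 q21 q22 addr0 add0r.
have i2 := has_index_equiv q22 q11 q12e ij.
have ip := has_index_equiv pp qq pq (has_index_sum q11 q22 q12 q21 ij i2).
have nj := has_index_uniq pp pn ip.
have [|jN] := leqP `|j| N0; last by lia.
by move=> /IH /(_ q11 ij) j0; rewrite nj j0.
Qed.

End CornerIndex.

(** * Halving idempotents over the CAR algebra *)

Section MatrixNorm.
Variables (R : realType) (A : cstarAlgType R) (k : nat).
Implicit Types (a b p q x y : 'M[A]_k).

Lemma cnorm_is_complete : is_complete_norm (@cnorm R A).
Proof.
have N0 : cnorm (0 : A) = 0.
  have := cnormZ (0 : R[i]) (0 : A); rewrite scaler0 normr0 mul0r.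
  by move/(congr1 (@complex.Re R)).
have NN (a : A) : cnorm (- a) = cnorm a.
  have := cnormZ (-1 : R[i]) a; rewrite scaleN1r normrN1 mul1r.
  by move/(congr1 (@complex.Re R)).
split=> //.
- by move=> x y; rewrite (le_trans (cnormD _ _)) // NN.
- exact: cnorm_eq0.
- exact: cnorm_complete.
Qed.

Definition mxnorm a : R := \sum_(ij : 'I_k * 'I_k) cnorm (a ij.1 ij.2).

Lemma mxnorm_complete : is_complete_norm mxnorm.
Proof.
apply: (@coordinatewise_complete R A 'M[A]_k ('I_k * 'I_k)%type (@cnorm R A)
  (fun a ij => a ij.1 ij.2) (fun g => \matrix_(i, j) g (i, j))
  cnorm_is_complete).
- by move=> g [i j]; rewrite mxE.
- by move=> x y [i j]; rewrite !mxE.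
- by move=> x x0; apply/matrixP=> i j; rewrite (x0 (i, j)) mxE.
Qed.

Lemma mxnormM x y : mxnorm (x * y) <= mxnorm x * mxnorm y.
Proof.
have ge0 := complete_norm_ge0 cnorm_is_complete.
have mxE2 (z : 'M[A]_k) : mxnorm z = \sum_i \sum_j cnorm (z i j).
  by rewrite pair_bigA.
rewrite [mxnorm (x * y)]mxE2 [mxnorm x]mxE2 mulr_suml; apply: ler_sum => i _.
apply: (@le_trans _ _ (\sum_j \sum_l cnorm (x i l) * cnorm (y l j))).
  apply: ler_sum => j _; rewrite mxE.
  elim/big_rec2: _ => [|l s t _ st].
    by rewrite (complete_norm0 cnorm_is_complete).
  by apply: le_trans (cnormD _ _) _; rewrite lerD // cnormM.
rewrite exchange_big /= mulr_suml; apply: ler_sum => l _.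
rewrite -mulr_sumr ler_wpM2l // mxE2 [leRHS](bigD1 l) //= lerDl.
by rewrite sumr_ge0 // => l' _; rewrite sumr_ge0.
Qed.

End MatrixNorm.

Lemma castmx_mulmx (A : pzRingType) (m n : nat) (e : m = n) (B D : 'M[A]_m) :
  castmx (e, e) B *m castmx (e, e) D = castmx (e, e) (B *m D).
Proof. by case: n / e; rewrite !castmx_id. Qed.

Section CAR.
Variables (R : realType) (A : cstarAlgType R).
Variable iota : forall n : nat, 'M[R[i]]_(2 ^ n) -> A.
Hypothesis car : is_CAR_limit iota.

Lemma iota_lift n N (B : 'M[R[i]]_(2 ^ n)) : (0 < n)%N -> (n <= N)%N ->
  exists B' : 'M[R[i]]_(2 ^ N), iota B' = iota B.
Proof.
move=> n0 /subnKC <-; elim: (N - n)%N => [|d [B' HB']].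
  by rewrite addn0; exists B.
rewrite addnS; exists (car_connect B').
by rewrite (car_compat car) // addn_gt0 n0.
Qed.

Definition two_by_two n (a b c d : 'M[R[i]]_(2 ^ n)) : 'M[R[i]]_(2 ^ n.+1) :=
  castmx (car_dim n, car_dim n) (block_mx a b c d).

Lemma two_by_two_mul n (a b c d a' b' c' d' : 'M[R[i]]_(2 ^ n)) :
  two_by_two a b c d *m two_by_two a' b' c' d' =
  two_by_two (a *m a' + b *m c') (a *m b' + b *m d')
             (c *m a' + d *m c') (c *m b' + d *m d').
Proof. by rewrite castmx_mulmx mulmx_block. Qed.

Lemma two_by_two_add n (a b c d a' b' c' d' : 'M[R[i]]_(2 ^ n)) :
  two_by_two a b c d + two_by_two a' b' c' d' =
  two_by_two (a + a') (b + b') (c + c') (d + d').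
Proof.
rewrite /two_by_two -add_block_mx; move: (car_dim n) => e.
by case: _ / e; rewrite !castmx_id.
Qed.

Lemma car_connect1 n : car_connect (1%:M : 'M[R[i]]_(2 ^ n)) = 1%:M.
Proof.
rewrite /car_connect -scalar_mx_block; move: (car_dim n) => e.
by case: _ / e; rewrite castmx_id.
Qed.

(** The images of the units of the matrix algebras all coincide with an element
    that is a left unit on a dense subset. *)
Lemma iota1 n : (0 < n)%N -> iota (1%:M : 'M[R[i]]_(2 ^ n)) = 1.
Proof.
move=> n0; set e := iota _.
have eE d : iota (1%:M : 'M[R[i]]_(2 ^ (n + d))) = e.
  elim: d => [|d IH]; first by rewrite addn0.
  by rewrite addnS -car_connect1 (car_compat car) ?IH // addn_gt0 n0.
have eB l (B : 'M[R[i]]_(2 ^ l)) : (0 < l)%N -> e * iota B = iota B.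
  move=> l0; have [B' <-] := iota_lift B l0 (leq_addl n l).
  by rewrite -(eE l) -(car_mul car) ?addn_gt0 ?n0 // mul1mx.
have NA := @cnorm_is_complete R A.
rewrite -[e]mulr1; apply/eqP; rewrite -subr_eq0.
apply/eqP/(complete_norm_eq0 NA) => d d0.
have C0 : 0 < cnorm e + 1 by rewrite ltr_wpDl ?(complete_norm_ge0 NA).
have [l [B [l0 HB]]] := car_dense car 1 (divr_gt0 d0 C0).
have -> : e * 1 - 1 = e * (1 - iota B) - (1 - iota B).
  by rewrite mulrBr eB // opprB addrA subrK.
apply: le_trans (complete_normB NA _ _) _.
apply: (@le_trans _ _ ((cnorm e + 1) * cnorm (1 - iota B))).
  by rewrite mulrDl mul1r lerD2r cnormM.
by rewrite mulrC -ler_pdivlMr // ltW.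
Qed.

Lemma scalar_comm (k : nat) (f : A) (b : 'M[A]_k) :
  (forall i j, f * b i j = b i j * f) ->
  f%:M * b = b * f%:M.
Proof.
move=> fb; apply/matrixP=> i j; rewrite !mxE (bigD1 i) //= [RHS](bigD1 j) //=.
rewrite !mxE !eqxx !mulr1n fb big1 ?[X in _ = _ + X]big1 //.
- by move=> l /negbTE lj; rewrite mxE lj mulr0.
- by move=> l; rewrite eq_sym mxE => /negbTE ->; rewrite mul0r.
Qed.

(** The element [b] commutes with the matrix units since, after one more
    connecting map, its entries are block diagonal with two equal blocks. *)
Lemma car_halving k (p : 'M[A]_k) : p * p = p ->
  exists q1 q2 : 'M[A]_k,
    [/\ q1 * q1 = q1, q2 * q2 = q2, q1 * q2 = 0 /\ q2 * q1 = 0,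
        alg_equiv p (q1 + q2) & alg_equiv q2 q1].
Proof.
move=> pp.
have [d d0 Hd] :=
  idempotent_perturbation (@mxnorm_complete R A k) (@mxnormM R A k) pp.
pose d' := d / (#|{: 'I_k * 'I_k}|.+1)%:R.
have d'0 : 0 < d' by rewrite divr_gt0.
have /choice[l Hl] : forall ij : 'I_k * 'I_k, exists l, (0 < l)%N /\
    exists B : 'M[R[i]]_(2 ^ l), cnorm (p ij.1 ij.2 - iota B) < d'.
  move=> ij; have [l [B [l0 HB]]] := car_dense car (p ij.1 ij.2) d'0.
  by exists l; split; [|exists B].
pose n := (\max_ij l ij).+1.
have n0 : (0 < n)%N by [].
have /choice[B HB] : forall ij : 'I_k * 'I_k, exists B : 'M[R[i]]_(2 ^ n),
    cnorm (p ij.1 ij.2 - iota B) < d'.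
  move=> ij; have [l0 [B HB]] := Hl ij.
  have ln : (l ij <= n)%N by rewrite ltnW // ltnS (leq_bigmax ij).
  by have [B' HB'] := iota_lift B l0 ln; exists B'; rewrite HB'.
pose b := \matrix_(i, j) iota (B (i, j)).
have bp : mxnorm (b - p) <= d.
  apply: (@le_trans _ _ (\sum_(ij : 'I_k * 'I_k) d')).
    apply: ler_sum => -[i j] _.
    rewrite !mxE (complete_norm_sym (@cnorm_is_complete R A)).
    exact/ltW/(HB (i, j)).
  rewrite sumr_const -mulr_natr /d' mulrAC ler_pdivrMr //.
  by rewrite ler_pM2l // ler_nat.
have [q [qq pq qc]] := Hd b bp.
(* Scalar 2 x 2 matrices over [A_n], inside [A_(n+1)] and then diagonally in
   the matrices over [A]. *)
pose E a c e f : 'M[A]_k := (iota (@two_by_two n a c e f))%:M.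
pose f11 := E 1%:M 0 0 0; pose f12 := E 0 1%:M 0 0.
pose f21 := E 0 0 1%:M 0; pose f22 := E 0 0 0 1%:M.
have EM a c e f a' c' e' f' : E a c e f * E a' c' e' f' =
    E (a *m a' + c *m e') (a *m c' + c *m f')
      (e *m a' + f *m e') (e *m c' + f *m f').
  by rewrite /E -mulmxE -scalar_mxM -(car_mul car) // two_by_two_mul.
have Eq a c e f : (forall ij, two_by_two a c e f *m car_connect (B ij) =
    car_connect (B ij) *m two_by_two a c e f) -> E a c e f * q = q * E a c e f.
  move=> H; apply: qc; apply: scalar_comm => i j; rewrite mxE.
  by rewrite -(car_compat car n0 (B (i, j))) -!(car_mul car) // H.
have iL := car_linear car (ltn0Sn n).
have E0 : E 0 0 0 0 = 0.
  rewrite /E /two_by_two -[block_mx _ _ _ _]/(block_mx 0 0 0 0) block_mx_const.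
  by rewrite castmx_const (lin0 iL) raddf0.
have f1 : f11 + f22 = 1.
  rewrite /f11 /f22 /E -raddfD -(linD _ _ iL) two_by_two_add !addr0 add0r.
  by rewrite (_ : two_by_two _ _ _ _ = car_connect 1%:M) // car_connect1 iota1.
have simp := (mul1mx, mulmx1, mulmx0, mul0mx, addr0, add0r).
have c11 : f11 * q = q * f11 by apply: Eq => ij; rewrite !two_by_two_mul !simp.
have c12 : f12 * q = q * f12 by apply: Eq => ij; rewrite !two_by_two_mul !simp.
have c21 : f21 * q = q * f21 by apply: Eq => ij; rewrite !two_by_two_mul !simp.
have c22 : f22 * q = q * f22 by apply: Eq => ij; rewrite !two_by_two_mul !simp.
have fqgq f g : g * q = q * g -> (f * q) * (g * q) = f * g * q.
  by move=> gq; rewrite -mulrA (mulrA q) -gq -[g * q * q]mulrA qq mulrA.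
exists (f11 * q), (f22 * q); split.
- by rewrite fqgq // EM !simp.
- by rewrite fqgq // EM !simp.
- by rewrite !fqgq // !EM !simp E0 !mul0r.
- by rewrite -mulrDl f1 mul1r.
- exists (f12 * q), (f21 * q); rewrite !fqgq // !EM !simp.
  by split.
Qed.

End CAR.

Lemma has_index_module_index (R : realType) (A : cstarAlgType R)
    (m : even_fredholm A) (p : projection A) n :
  has_index m (pmx p) n -> module_index m p n.
Proof.
have pp : pmx p * pmx p = pmx p by case: (pmxP p).
have sD := corner_subspace m pp (sqr1 R).
have sE := corner_subspace m pp (sqrN1 R).
have TL := (corner_operator_bounded m (pmx p)).1.
have DE v : corner (m := m) (pmx p) 1 v ->
    corner (m := m) (pmx p) (-1) (corner_operator (m := m) (pmx p) v).
  exact: corner_operator_corner.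
move/(fredholm_index_kernel sD sE TL DE) => [a [b [ka Eb nE]]].
rewrite /module_index !corner_spaceE //; exists a, b; split=> //.
- apply: (codim_quot_dim (subspace_ker sD TL) (@subspace0 _ _)) ka.
  by move=> _ ->; split; [case: sD | exact: lin0].
- apply: (codim_quot_dim sE (subspace_img sD TL)) Eb.
  by move=> _ [v Dv <-]; exact: DE.
Qed.

Theorem corollary6 (R : realType) (A : cstarAlgType R) (hA : is_CAR_algebra A)
  (z : KK0 A) (x : K0 A) : index_pairing z x 0%R.
Proof.
case: hA => iota car m p q _ _; exists 0, 0; rewrite subr0.
have index0 (r : projection A) : module_index m r 0.
  apply: has_index_module_index; apply: has_index_halving.
    by move=> e; exact: (car_halving car).
  by case: (pmxP r).
by split.
Qed.
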